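(* Let $k\geq2$ and $n=2$. Then the conditional matching preclusion number of the DCell is $mp_1(D_{k,2})=2n+2k-4=2k$. Moreover, $D_{k,2}$ is conditionally super matched for $k\geq3$.
   Context: DCell $D_{k,n}$ ($n\geq 2$, $k\geq 0$) is defined recursively. $D_{0,n}$ is the complete graph $K_n$ on vertices $0,1,\dots,n-1$. Let $t_{k,n}=|V(D_{k,n})|$. For $k\geq1$, $D_{k,n}$ is built from $t_{k-1,n}+1$ disjoint copies $D^0_{k-1,n},\dots,D^{t_{k-1,n}}_{k-1,n}$ of $D_{k-1,n}$; a vertex of copy $D^i_{k-1,n}$ is labeled $(i,a_{k-1},\dots,a_0)$, where $(a_{k-1},\dots,a_0)$ is its label in $D_{k-1,n}$, and its index within the copy is $uid_{k-1}=a_0+\sum_{l=1}^{k-1}a_l t_{l-1,n}$. For each pair $a<b$ of copy indices, one edge joins the vertex of $D^a_{k-1,n}$ with $uid_{k-1}=b-1$ to the vertex of $D^b_{k-1,n}$ with $uid_{k-1}=a$. For a graph $G$ of even order, $mp_1(G)$ is the minimum number of edges whose deletion yields a graph with neither a perfect matching nor an isolated vertex. Let $v_e(G)=\min\{d_G(u)+d_G(w)-2-y_G(u,w)\}$ over all pairs $u,w$ that are the ends of a path $u v w$ of length $2$, where $y_G(u,w)=1$ if $uw\in E(G)$ and $0$ otherwise. A trivial optimal conditional solution is, for such a path $uvw$ attaining $v_e(G)$, the set of all edges incident to $u$ or $w$ other than $uv$ and $vw$. $G$ is conditionally super matched if $mp_1(G)=v_e(G)$ and every set of $mp_1(G)$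 edges whose deletion leaves a graph with no perfect matching and no isolated vertex is a trivial optimal conditional solution. *)

(* Defs.v *)
From mathcomp Require Import all_boot.

Set Implicit Arguments.
Unset Strict Implicit.
Unset Printing Implicit Defensive.

Record sgraph := SGraph {
  svertex :> finType;
  adj : rel svertex;
  adj_sym : symmetric adj;
  adj_irrefl : irreflexive adj
}.

Arguments adj {s} _ _.

Definition degree (G : sgraph) (u : G) : nat := #|[set v | adj u v]|.

Definition edges (G : sgraph) : {set {set G}} :=
  [set [set p.1; p.2] | p : G * G & adj p.1 p.2].

Definition del_adj (G : sgraph) (F : {set {set G}}) : rel G :=
  fun u v => adj u v && ([set u; v] \notin F).

Fact del_adj_sym (G : sgraph) (F : {set {set G}}) : symmetric (del_adj F).
Proof. by move=> u v; rewrite /del_adj adj_sym setUC. Qed.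

Fact del_adj_irrefl (G : sgraph) (F : {set {set G}}) : irreflexive (del_adj F).
Proof. by move=> u; rewrite /del_adj adj_irrefl. Qed.

Definition del_edges (G : sgraph) (F : {set {set G}}) : sgraph :=
  SGraph (del_adj_sym F) (del_adj_irrefl F).

Definition perfect_matching (G : sgraph) (M : {set {set G}}) : bool :=
  (M \subset edges G) && [forall v : G, #|[set e in M | v \in e]| == 1].

Definition has_perfect_matching (G : sgraph) : bool :=
  [exists M : {set {set G}}, perfect_matching M].

Definition has_isolated_vertex (G : sgraph) : bool :=
  [exists v : G, degree v == 0].

Definition cond_preclusion (G : sgraph) (F : {set {set G}}) : bool :=
  [&& F \subset edges G,
      ~~ has_perfect_matching (del_edges F)
    & ~~ has_isolated_vertex (del_edges F)].

(* "mp_1(G) = m", as a relation: mp_1(G) is a minimum over a family of edge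
   sets that is empty for some graphs, and asserting a value includes
   asserting that the minimum exists. The same holds for is_ve below. *)
Definition is_mp1 (G : sgraph) (m : nat) : Prop :=
  (exists2 F : {set {set G}}, cond_preclusion F & #|F| = m) /\
  (forall F : {set {set G}}, cond_preclusion F -> m <= #|F|).

Definition path2 (G : sgraph) (u v w : G) : bool :=
  [&& u != w, adj u v & adj v w].

(* On the ends of a path of length 2 the truncated subtractions are exact;
   y_G(u, w) is the boolean [adj u w] read as 0 or 1. *)
Definition ve_val (G : sgraph) (u w : G) : nat :=
  degree u + degree w - 2 - adj u w.

Definition is_ve (G : sgraph) (m : nat) : Prop :=
  (exists u v w : G, path2 u v w /\ ve_val u w = m) /\
  (forall u v w : G, path2 u v w -> m <= ve_val u w).

Definition trivial_cond_solution (G : sgraph) (F : {set {set G}}) : Prop :=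
  exists u v w : G,
    [/\ path2 u v w,
        is_ve G (ve_val u w)
      & F = [set e in edges G | (u \in e) || (w \in e)]
              :\: [set [set u; v]; [set v; w]]].

Definition cond_super_matched (G : sgraph) : Prop :=
  exists m : nat,
    [/\ is_mp1 G m,
        is_ve G m
      & forall F : {set {set G}},
          cond_preclusion F -> #|F| = m -> trivial_cond_solution F].

(* A vertex of D_{k,n} is its label (a_k, (a_{k-1}, (..., a_0))), as nested pairs;
   there are t_{k-1,n} + 1 copies of D_{k-1,n} in D_{k,n}. *)
Fixpoint dcell_vertex (k n : nat) : finType :=
  if k is k'.+1 then
    ('I_(#|dcell_vertex k' n|.+1) * dcell_vertex k' n)%type : finType
  else 'I_n : finType.

Definition dcell_order (k n : nat) : nat := #|dcell_vertex k n|.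

(* uid_k = a_0 + \sum_(1 <= l <= k) a_l * t_{l-1,n}. *)
Fixpoint dcell_uid (k n : nat) : dcell_vertex k n -> nat :=
  match k return dcell_vertex k n -> nat with
  | 0 => fun a => nat_of_ord a
  | k'.+1 => fun x => x.1 * dcell_order k' n + dcell_uid x.2
  end.

(* For a < b, the only edge between copies a and b joins the vertex of uid
   b - 1 in copy a to the vertex of uid a in copy b. *)
Definition dcell_link (k n : nat) (x y : dcell_vertex k.+1 n) : bool :=
  [&& x.1 < y.1, dcell_uid x.2 == y.1 - 1 & dcell_uid y.2 == x.1].

Fixpoint dcell_adj (k n : nat) : rel (dcell_vertex k n) :=
  match k return rel (dcell_vertex k n) with
  | 0 => fun a b => a != b
  | k'.+1 => fun x y =>
      [|| (x.1 == y.1) && dcell_adj x.2 y.2, dcell_link x y | dcell_link y x]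
  end.

Fact dcell_adj_sym (k n : nat) : symmetric (@dcell_adj k n).
Proof.
elim: k => [|k IHk] x y /=; first by rewrite eq_sym.
by rewrite eq_sym IHk [dcell_link x y || _]orbC.
Qed.

Fact dcell_adj_irrefl (k n : nat) : irreflexive (@dcell_adj k n).
Proof.
by elim: k => [|k IHk] x /=; rewrite ?eqxx // IHk /dcell_link ltnn.
Qed.

Definition dcell (k n : nat) : sgraph :=
  SGraph (@dcell_adj_sym k n) (@dcell_adj_irrefl k n).

(* Main.v *)
(** The edges of each recursion level of D_{k,2} form a perfect matching, so D_{k,2}
    is (k+1)-regular and properly coloured by k+1 perfect matchings; it has neither
    triangles nor squares. A set F of at most 2k faults that precludes perfect
    matchings contains a link of the last level, so all copies of D_{k-1,2} but one,
    say copy i, keep a perfect matching, and copy i loses at least k edges.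

    One looks for a matching of copy i that misses two vertices, and joins these two
    through other copies. A third copy that meets no fault is always available, and
    D_{k-1,2} is bicritical, so only the copies that are entered with faults matter;
    there a colour class without fault, possibly shifted along one edge, gives enough
    exits. If a vertex u is isolated in copy i, this fails only if all other faults
    surround a vertex at distance 2 from u. Otherwise the bound for D_{k-1,2} shows that
    copy i has 2k-2 or 2k-1 faults; removing one or two of them gives the required
    matching, unless the faults are those at two vertices of copy i, each with a
    single remaining neighbour. If these neighbours coincide, F is trivial; otherwise
    a shifted colour class works.

    For k = 2, faults matter only if they have three different colours, and twelve
    perfect matchings suffice to avoid all such triples that isolate no vertex. *)

Require Import Defs.
From mathcomp Require Import all_boot.
From mathcomp Require Import zify.

Set Implicit Arguments.
Unset Strict Implicit.
Unset Printing Implicit Defensive.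

(** * Counting and sets of two elements *)

Section Counting.

Variables (A B : finType).

(** [R] acts as a partial function from [O] onto [X]. Below, distinct objects are charged to
    distinct faults in this way. *)
Lemma card_le_rel (O : {set A}) (X : {set B}) (R : A -> B -> bool) :
    (forall f x y, R f x -> R f y -> x = y) ->
    (forall x, x \in X -> exists2 f, f \in O & R f x) ->
  #|X| <= #|O|.
Proof.
move=> Rfun XR.
have h x : x \in X -> Some x \in [set [pick y | R f y] | f in O].
  move=> /XR[f fO Rfx]; apply/imsetP; exists f => //.
  by case: pickP => [y /(Rfun _ _ _ Rfx)->|/(_ x)]; rewrite ?Rfx.
have Si : injective (@Some B) by move=> ? ? [].
rewrite -(card_imset _ Si).
apply: leq_trans (leq_imset_card (fun f => [pick y | R f y]) O).
by apply: subset_leq_card; apply/subsetP=> _ /imsetP[x /h ? ->].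
Qed.

Lemma card_setN (X : {set A}) : #|~: X| = #|A| - #|X|.
Proof. by rewrite -(cardsC X) addKn. Qed.

End Counting.

Lemma set2_eq (T : finType) (a b c d : T) :
  [set a; b] = [set c; d] -> (a = c /\ b = d) \/ (a = d /\ b = c).
Proof.
move=> E.
have : a \in [set c; d] by rewrite -E set21.
have : b \in [set c; d] by rewrite -E set22.
have : c \in [set a; b] by rewrite E set21.
have : d \in [set a; b] by rewrite E set22.
by rewrite !inE => /orP[]/eqP-> /orP[]/eqP-> /orP[]/eqP ? /orP[]/eqP ?;
  subst; auto.
Qed.

(** * Matchings avoiding faults *)

Section Matchable.

Variable T : finType.
Implicit Types (e : rel T) (S X : {set T}) (F : {set {set T}}).

(** For [e] the adjacency of a graph, this unfolds to [del_adj]; a bare relation lets the same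
    notion serve the copies, which are not packed as graphs. *)
Definition live e F : rel T := fun x y => e x y && ([set x; y] \notin F).

(** A perfect matching of the subgraph induced on [S], encoded as an involution of [S], so that
    colour classes and links are matchings as they stand. *)
Definition matchable e S : bool :=
  [exists m : {ffun T -> T},
    [forall x in S, [&& m x \in S, m (m x) == x & e x (m x)]]].

Lemma matchableP e S :
  reflect (exists m : T -> T, forall x, x \in S ->
             [/\ m x \in S, m (m x) = x & e x (m x)])
          (matchable e S).
Proof.
apply: (iffP existsP) => [[m /forall_inP mP]|[m mP]].
  by exists m => x /mP/and3P[? /eqP].
exists (finfun m); apply/forall_inP=> x /mP[? mm ?].
by rewrite !ffunE mm eqxx; apply/and3P.
Qed.

Lemma matchable_sub e e' S :
    (forall x y, x \in S -> y \in S -> e x y -> e' x y) ->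
  matchable e S -> matchable e' S.
Proof.
move=> ee' /matchableP[m mP]; apply/matchableP; exists m => x xS.
by have [? ? ?] := mP x xS; split=> //; apply: ee'.
Qed.

Lemma matchable0 e : matchable e set0.
Proof. by apply/matchableP; exists id => x; rewrite inE. Qed.

Lemma matchableU e S X :
  [disjoint S & X] -> matchable e S -> matchable e X -> matchable e (S :|: X).
Proof.
move=> dSX /matchableP[m mP] /matchableP[p pP].
apply/matchableP; exists (fun x => if x \in S then m x else p x) => x.
rewrite in_setU; case: (boolP (x \in S)) => [xS _|xS /= xX].
  by have [mS mm em] := mP x xS; rewrite mS inE mS.
have [pX pp ep] := pP x xX.
by rewrite inE pX orbT (disjointFl dSX pX) pp.
Qed.

Lemma matchable2 e x y :
  symmetric e -> x != y -> e x y -> matchable e [set x; y].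
Proof.
move=> se xy exy; apply/matchableP; exists (fun z => if z == x then y else x) => z.
have yx : (y == x) = false by rewrite eq_sym (negPf xy).
by rewrite !inE => /orP[]/eqP->; rewrite ?eqxx ?yx ?eqxx ?orbT //= ?(se y).
Qed.

Lemma matchableU2 e S x y :
    symmetric e -> x != y -> e x y -> x \notin S -> y \notin S ->
  matchable e S -> matchable e (x |: (y |: S)).
Proof.
move=> se xy exy xS yS mS; rewrite setUA setUC.
apply: matchableU => //; last exact: matchable2.
by rewrite disjoint_sym disjoints_subset subUset !sub1set !inE xS.
Qed.

Lemma live_sym e F : symmetric e -> symmetric (live e F).
Proof. by move=> se x y; rewrite /live se setUC. Qed.

Lemma live_sub e F F' :
  F' \subset F -> forall x y, live e F x y -> live e F' x y.
Proof.
move=> FF x y /andP[exy nF]; apply/andP; split=> //.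
by apply: contraNN nF; apply: (subsetP FF).
Qed.

Definition edge_set e F : Prop :=
  forall f, f \in F -> exists x y, e x y /\ f = [set x; y].

Lemma edge_set_sub e F F' : F' \subset F -> edge_set e F -> edge_set e F'.
Proof. by move=> /subsetP FF h f /FF/h. Qed.

(** A matching that avoids all faults but [f] either does not use [f], or uses it and then exposes
    just its two ends once [f] is dropped. *)
Lemma matchable_restore e F f S :
    symmetric e -> irreflexive e -> edge_set e F -> f \in F ->
    matchable (live e (F :\ f)) S ->
  matchable (live e F) S \/ f \subset S /\ matchable (live e F) (S :\: f).
Proof.
move=> se ie eF /[dup] fF /eF[x [y [exy fE]]] /matchableP[m mP].
have [/andP[xS /eqP mx]|nx] := boolP ((x \in S) && (m x == y)).
  right; have [yS my _] := mP x xS; rewrite mx in yS my.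
  split; first by rewrite fE subUset !sub1set xS.
  apply/matchableP; exists m => z; rewrite fE !inE negb_or => /andP[/andP[zx zy] zS].
  have [mS mm /andP[em]] := mP z zS; rewrite in_setD1 => nF; split=> //.
    rewrite mS andbT; apply/norP; split; apply/eqP=> mz.
      by move: zy; rewrite -mm mz mx eqxx.
    by move: zx; rewrite -mm mz my eqxx.
  apply/andP; split=> //; apply: contraNN nF => ->; rewrite andbT.
  rewrite fE; apply/eqP=> /set2_eq[][zE _]; first by rewrite zE eqxx in zx.
  by rewrite zE eqxx in zy.
left; apply/matchableP; exists m => z zS.
have [mS mm /andP[em]] := mP z zS; rewrite in_setD1 => nF; split=> //.
apply/andP; split=> //; apply: contraNN nF => ->; rewrite andbT fE.
apply: contraNN nx => /eqP/set2_eq[][<- <-]; first by rewrite zS eqxx.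
by rewrite mS mm eqxx.
Qed.

End Matchable.

(** * Edge-coloured graphs *)

(** A proper edge colouring whose [d] classes are perfect matchings, each given as an involution; in
    particular [e] is [d]-regular. *)
Definition colouring (T : finType) (e : rel T) (d : nat) (c : nat -> T -> T) : Prop :=
  [/\ forall j x, j < d -> c j (c j x) = x,
      forall j l x, j < d -> l < d -> c j x = c l x -> j = l
    & forall x y, e x y <-> exists2 j, j < d & c j x = y].

Definition triangle_free (T : finType) (e : rel T) : Prop :=
  forall x y z, e x y -> e y z -> ~~ e x z.

Definition square_free (T : finType) (e : rel T) : Prop :=
  forall x y u v, e x u -> e u y -> e x v -> e v y -> x != y -> u = v.

Definition bicritical (T : finType) (e : rel T) : Prop :=
  forall x y, x != y -> matchable e (~: [set x; y]).

Section Coloured.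

Variables (T : finType) (e : rel T) (d : nat) (c : nat -> T -> T).
Hypotheses (se : symmetric e) (ie : irreflexive e) (col : colouring e d c).
Implicit Types (H : {set {set T}}) (j : nat).

Let cK j x : j < d -> c j (c j x) = x. Proof. by case: col => h _ _ /h. Qed.
Let c_inj j l x : j < d -> l < d -> c j x = c l x -> j = l.
Proof. by case: col => _ h _; apply: h. Qed.
Let cO_inj (j l : 'I_d) x : c j x = c l x -> j = l.
Proof. by move/c_inj=> h; apply/val_inj/h. Qed.
Let eP x y : e x y <-> exists2 j, j < d & c j x = y.
Proof. by case: col => _ _; apply. Qed.

Lemma colour_edge j x : j < d -> e x (c j x).
Proof. by move=> jd; apply/eP; exists j. Qed.

Lemma colour_neq j x : j < d -> c j x != x.
Proof.
move=> jd; apply/negP=> /eqP cx; have := colour_edge x jd.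
by rewrite cx ie.
Qed.

Lemma colour_eq j x y : j < d -> (c j x == c j y) = (x == y).
Proof.
by move=> jd; apply/eqP/eqP=> [h|->//]; rewrite -(cK x jd) h cK.
Qed.

Lemma colour_eqC j x y : j < d -> (c j x == y) = (x == c j y).
Proof. by move=> jd; rewrite -(colour_eq _ _ jd) cK. Qed.

Lemma card_neighbours x : #|[set y | e x y]| = d.
Proof.
rewrite -[RHS](card_ord d) -(@card_imset _ _ (fun j : 'I_d => c j x)).
  apply: eq_card => y; rewrite inE; apply/idP/imsetP.
    by case/eP=> j jd <-; exists (Ordinal jd).
  by case=> j _ ->; apply: colour_edge.
by move=> j l /cO_inj.
Qed.

Definition star x : {set {set T}} := [set [set x; y] | y in [set y | e x y]].

Lemma set2_inj x : injective (fun y => [set x; y] : {set T}).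
Proof. by move=> y z /set2_eq[][] // -> ->. Qed.

Lemma card_star x : #|star x| = d.
Proof. by rewrite card_imset ?card_neighbours //; apply: set2_inj. Qed.

Lemma starP x f : f \in star x -> exists2 y, e x y & f = [set x; y].
Proof. by case/imsetP=> y; rewrite inE; exists y. Qed.

Lemma star_mem F x f : edge_set e F -> f \in F -> x \in f -> f \in star x.
Proof.
move=> eF /eF[y [z [yz ->]]]; rewrite !inE => /orP[]/eqP->.
  by apply/imsetP; exists z; rewrite ?inE.
by apply/imsetP; exists y; rewrite ?inE 1?se // setUC.
Qed.

(** An edge has only one colour, so each element of [H] spoils at most one class. *)
Lemma colours_missed H :
  d - #|H| <= #|[set j : 'I_d | [forall x, [set x; c j x] \notin H]]|.
Proof.
set J := [set j | _]; have := cardsC J; rewrite card_ord => JC.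
suff : #|~: J| <= #|H| by lia.
apply: (card_le_rel (R := fun f (j : 'I_d) => [exists x, f == [set x; c j x]])).
  move=> f j l /existsP[x /eqP->] /existsP[y /eqP/set2_eq[][xy h]].
    by apply: (@cO_inj _ _ x); rewrite h xy.
  by apply: (@cO_inj _ _ x); rewrite h xy cK.
move=> j; rewrite !inE negb_forall => /existsP[x]; rewrite negbK => xH.
by exists [set x; c j x] => //; apply/existsP; exists x.
Qed.

Lemma matchable_colour H j (S : {set T}) :
    j < d -> (forall x, x \in S -> c j x \in S /\ [set x; c j x] \notin H) ->
  matchable (live e H) S.
Proof.
move=> jd h; apply/matchableP; exists (c j) => x /h[? ?].
by split; rewrite ?cK // /live colour_edge.
Qed.

Lemma matchable_few H : #|H| < d -> matchable (live e H) setT.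
Proof.
move=> Hd; have := colours_missed H.
case: (pickP [pred j in [set j : 'I_d | [forall x, [set x; c j x] \notin H]]]).
  move=> j; rewrite !inE => /forallP nH _.
  by apply: (@matchable_colour _ j) => // x; rewrite inE.
by move=> J0; rewrite (eq_card0 J0); lia.
Qed.

(** Colour class [j] without its edge at [x]; whether that edge is faulty does not matter. *)
Lemma matchable_pair H j x :
    j < d -> (forall y, y != x -> y != c j x -> [set y; c j y] \notin H) ->
  matchable (live e H) (~: [set x; c j x]).
Proof.
move=> jd h; apply: (matchable_colour jd) => y.
rewrite !inE !negb_or colour_eqC // colour_eq // => /andP[yx ycx].
by rewrite yx ycx h.
Qed.

(** In colour class [j], the two edges at [p] and [y] are exchanged for the single edge [p y], which
    exposes the other ends of the two edges and tolerates faults on both. *)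
Lemma matchable_shift H j p y :
    j < d -> live e H p y -> y != c j p ->
    (forall z, z != p -> z != c j p -> z != y -> z != c j y ->
       [set z; c j z] \notin H) ->
  matchable (live e H) (~: [set c j p; c j y]).
Proof.
move=> jd py yp h.
have npy : p != y by apply: contraTneq py => ->; rewrite /live ie.
have -> : ~: [set c j p; c j y]
        = p |: (y |: ~: ([set c j p; c j y] :|: [set p; y])).
  apply/setP=> z; rewrite !inE !negb_or -!colour_eqC //.
  case: (eqVneq z p) => [->|zp] /=; first by rewrite colour_neq // eq_sym yp.
  case: (eqVneq z y) => [->|zy] //=; last by rewrite !andbT.
  by rewrite colour_neq // andbT colour_eqC.
apply: matchableU2; rewrite ?inE ?eqxx ?orbT //; first exact: live_sym.
apply: (matchable_colour jd) => z.
rewrite !inE !negb_or => /andP[/andP[zcp zcy] /andP[zp zy]].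
by rewrite !colour_eq // !colour_eqC // zcp zcy zp zy; split=> //; apply: h.
Qed.

(* The exits [c j x], for the colours [j] without fault, exhaust [B] in the bad
   case. Then either shifting the colour class along one more edge gives a new
   exit, which is not in [B] since there is no square, or all the edges at
   [c j x] are faulty. *)
Lemma exit_exists H (B : {set T}) x (H' := [set f in H | x \notin f]) :
    square_free e -> bicritical e -> d.+1 < #|T| ->
    #|H'| <= d.-1 -> #|B| <= d - #|H'| ->
  (exists q, [/\ q != x, q \notin B & matchable (live e H) (~: [set x; q])]) \/
  (exists p, [/\ e x p, p \in B, d.-1 <= #|H'|
               & forall y, e p y -> y != x -> [set p; y] \in H']).
Proof.
move=> c4 bic dT hH' hB.
have H'P q : matchable (live e H') (~: [set x; q]) ->
             matchable (live e H) (~: [set x; q]).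
  apply: matchable_sub => y z; rewrite !inE !negb_or => /andP[yx _] /andP[zx _].
  by rewrite /live !inE !negb_or eq_sym yx eq_sym zx !andbT.
(* If all faults are at [x], bicriticality makes every vertex an exit, and [d.+1 < #|T|] leaves one
   outside [B]. *)
have [H'0|/set0Pn[f0 f0H']] := eqVneq H' set0.
  have /set0Pn[q] : ~: (x |: B) != set0.
    rewrite -card_gt0 card_setN subn_gt0.
    rewrite cardsU1; apply: leq_trans dT; rewrite ltnS -add1n.
    by apply: leq_add; [case: (x \notin B) | rewrite H'0 cards0 subn0 in hB].
  rewrite !inE negb_or => /andP[qx qB]; left; exists q; split=> //.
  apply: H'P; apply: matchable_sub (bic _ _ _); last by rewrite eq_sym.
  by move=> y z _ _; rewrite /live H'0 inE andbT.
have H'1 : 0 < #|H'| by apply/card_gt0P; exists f0.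
set J := [set j : 'I_d | [forall y, [set y; c j y] \notin H']].
have Jd : d - #|H'| <= #|J| := colours_missed H'.
have exJ (j : 'I_d) : j \in J -> matchable (live e H) (~: [set x; c j x]).
  rewrite inE => /forallP nH.
  by apply/H'P/matchable_pair => // y _ _; apply: nH.
have cjx (j : 'I_d) : c j x != x by rewrite colour_neq.
have [j /andP[jJ jB]|JB] := pickP [pred j : 'I_d | (j \in J) && (c j x \notin B)].
  by left; exists (c j x); split=> //; apply: exJ.
have BE : B = [set c j x | j : 'I_d in J].
  apply/esym/eqP; rewrite eqEcard; apply/andP; split.
    apply/subsetP=> _ /imsetP[j jJ ->]; have := JB j; rewrite /= jJ /=.
    by move/negbFE.
  rewrite card_imset; first exact: leq_trans hB _.
  by move=> j l /cO_inj.
have /set0Pn[j jJ] : J != set0 by rewrite -card_gt0; lia.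
have /forallP nH : [forall y, [set y; c j y] \notin H'] by move: jJ; rewrite inE.
have jd := ltn_ord j.
have [y /and3P[py yx pyH]|all_faulty] :=
  pickP [pred y | [&& e (c j x) y, y != x & [set c j x; y] \notin H']].
  left; exists (c j y); split.
  - by rewrite colour_eqC //; apply: contraTneq py => ->; rewrite ie.
  - rewrite BE; apply/imsetP=> -[l lJ clx].
    have : c l x = c j x.
      apply: (c4 x y); rewrite ?colour_edge ?py 1?eq_sym //.
      by rewrite -clx se colour_edge.
    by move/eqP; rewrite -clx colour_eq // (negPf yx).
  - apply: H'P; have -> : x = c j (c j x) by rewrite cK.
    by apply: matchable_shift; rewrite ?cK // /live py.
right; exists (c j x); split; first exact: colour_edge.
- by rewrite BE; apply/imsetP; exists j.
- have -> : d.-1 = #|star (c j x) :\ [set c j x; x]|.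
    have := cardsD1 [set c j x; x] (star (c j x)); rewrite card_star.
    suff -> : [set c j x; x] \in star (c j x) by move/(congr1 predn).
    by apply/imsetP; exists x; rewrite // inE se colour_edge.
  apply: subset_leq_card; apply/subsetP=> f /setD1P[fx /starP[y ey fE]].
  have := all_faulty y; rewrite /= ey -fE /= => /negbT; rewrite negb_and !negbK.
  by case/orP=> // /eqP yx; rewrite fE yx eqxx in fx.
- move=> y ey yx; have := all_faulty y; rewrite /= ey yx /=.
  by move/negbFE.
Qed.

End Coloured.

(** * Graphs made of linked copies *)

Section Copies.

Variables (V I : finType) (A : rel V) (d : nat) (c : nat -> V -> V).
Notation W := (I * V)%type.
Variables (AW : rel W) (L : W -> W) (p : I -> I -> V).
Hypotheses (sA : symmetric A) (iA : irreflexive A) (colA : colouring A d c).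
Hypotheses (LK : involutive L) (L_neq : forall w, (L w).1 != w.1).
Hypotheses (Lp : forall a b, a != b -> L (a, p a b) = (b, p b a)).
Hypotheses (L_port : forall w, w.2 = p w.1 (L w).1).
Hypothesis AWE : forall w z, AW w z = ((w.1 == z.1) && A w.2 z.2) || (L w == z).

Lemma link_eqC w z : (L w == z) = (w == L z).
Proof. by rewrite -(inj_eq (inv_inj LK)) LK. Qed.

Lemma copies_sym : symmetric AW.
Proof. by move=> w z; rewrite !AWE eq_sym sA link_eqC [w == _]eq_sym. Qed.

Lemma copies_irrefl : irreflexive AW.
Proof.
move=> w; rewrite AWE iA andbF; apply/negP=> /eqP Lw.
by have := L_neq w; rewrite Lw eqxx.
Qed.

(** Two copies are joined by a single link, since a vertex is determined by its copy and the copy it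
    is linked to. *)
Lemma link_unique w z : w.1 = z.1 -> (L w).1 = (L z).1 -> w = z.
Proof.
move=> wz Lwz; have := L_port w; have := L_port z; rewrite -Lwz -wz => <-.
by case: w z wz {Lwz} => [a x] [b y] /= -> ->.
Qed.

Lemma copies_link w : AW w (L w). Proof. by rewrite AWE eqxx orbT. Qed.

Lemma copies_inner a x y : AW (a, x) (a, y) = A x y.
Proof.
rewrite AWE /= eqxx /=; case: eqP => [h|]; last by rewrite orbF.
by have := L_neq (a, x); rewrite h eqxx.
Qed.

Definition copies_colour j (w : W) : W := if j < d then (w.1, c j w.2) else L w.

Lemma copies_colouring : colouring AW d.+1 copies_colour.
Proof.
case: colA => cK c_inj eP; rewrite /copies_colour; split.
- move=> j w _; case: ltnP => jd /=; last by rewrite LK.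
  by rewrite /= cK //; case: w.
- move=> j l w jd ld; case: ltnP => jd'; case: ltnP => ld'.
  + by case=> /c_inj->.
  + by move=> h; have := L_neq w; rewrite -h eqxx.
  + by move=> h; have := L_neq w; rewrite h eqxx.
  + by lia.
- move=> w z; rewrite AWE; split.
    case/orP=> [/andP[/eqP wz /eP[j jd h]]|/eqP<-].
      by exists j; [lia | rewrite jd h wz; case: (z)].
    by exists d; rewrite ?ltnn.
  case=> j _; case: ltnP => jd <-; last by rewrite eqxx orbT.
  by rewrite /= eqxx /=; apply/orP; left; apply/eP; exists j.
Qed.

(** A closed walk that leaves a copy needs another link to return. Two consecutive links coincide,
    so a triangle would lie in one copy. *)
Lemma copies_triangle_free : triangle_free A -> triangle_free AW.
Proof.
move=> tA x y z; rewrite !AWE.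
have no3 (w u : W) : (L w).1 = u.1 -> w.1 = u.1 -> False.
  by move=> <- /eqP; rewrite eq_sym (negPf (L_neq w)).
case/orP=> [/andP[/eqP xy Axy]|/eqP xy] /orP[/andP[/eqP yz Ayz]|/eqP yz].
- rewrite xy yz eqxx /= negb_or (tA _ _ _ Axy Ayz) /=.
  by apply/eqP=> h; apply: (no3 x z); rewrite ?h // xy yz.
- rewrite negb_or -[z]yz xy eq_sym (negPf (L_neq y)) /=.
  rewrite (inj_eq (inv_inj LK)); apply: contraTneq Axy => ->.
  by rewrite iA.
- rewrite negb_or -yz -xy eq_sym (negPf (L_neq x)) /=.
  by apply: contraTneq Ayz => <-; rewrite xy iA.
- have <- : x = z by rewrite -yz -xy LK.
  by rewrite iA andbF /=; apply/eqP=> h; have := L_neq x; rewrite h eqxx.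
Qed.

(** If one side of a square is a link, both adjacent sides are inner, so the opposite side is a
    second link between the same two copies, against [link_unique]. Hence a square lies in one
    copy. *)
Lemma copies_square_free : square_free A -> square_free AW.
Proof.
move=> qA.
have link_case x y u v : AW u y -> AW x v -> AW v y -> x != y -> u != v ->
    L x = u -> False.
  move=> uy xv vy xy uv Lx.
  have {}uy : u.1 = y.1.
    move: uy; rewrite AWE => /orP[/andP[/eqP //]|/eqP Lu].
    by move: xy; rewrite -Lu -Lx LK eqxx.
  have xv1 : x.1 = v.1.
    move: xv; rewrite AWE => /orP[/andP[/eqP //]|/eqP Lv].
    by move: uv; rewrite -Lv Lx eqxx.
  move: vy; rewrite AWE => /orP[/andP[/eqP vy _]|/eqP Lv].
    by have := L_neq x; rewrite Lx uy -vy xv1 eqxx.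
  have vx : v = x by apply: link_unique; rewrite ?xv1 // Lv -uy Lx.
  by move: xv; rewrite vx copies_irrefl.
move=> x y u v xu uy xv vy xy; apply/eqP/negPn/negP=> uv.
have vu : v != u by rewrite eq_sym.
have yx : y != x by rewrite eq_sym.
have AWs := copies_sym.
have inner w z : AW w z -> L w <> z -> w.1 = z.1 /\ A w.2 z.2.
  by rewrite AWE => /orP[/andP[/eqP]|/eqP].
have [] := inner _ _ xu; first exact: (link_case x y u v).
have [] := inner _ _ xv; first exact: (link_case x y v u).
have [] := inner y u; first by rewrite AWs.
  by apply: (link_case y x u v) => //; rewrite AWs.
have [] := inner y v; first by rewrite AWs.
  by apply: (link_case y x v u) => //; rewrite AWs.
move=> yv1 yv2 yu1 yu2 xv1 xv2 xu1 xu2.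
have uv2 : u.2 = v.2.
  apply: (qA x.2 y.2); rewrite // 1?sA //.
  apply: contraNneq xy => xy2; rewrite [x]surjective_pairing xu1 -yu1 xy2.
  by case: (y).
by case/eqP: uv; rewrite [u]surjective_pairing uv2 -xu1 xv1; case: (v).
Qed.

(** * Matchings extended from copy to copy *)

Section Faults.

Variable F : {set {set W}}.
Hypothesis eF : edge_set AW F.
Hypothesis bicA : bicritical A.
Notation lW := (live AW F).
Implicit Types (U Z : {set I}) (X : {set W}).

Definition at_copy (a : I) (x : V) : W := (a, x).
Definition layer (a : I) : {set {set V}} := [set f : {set V} | at_copy a @: f \in F].
Definition copies U : {set W} := [set w : W | w.1 \in U].
Definition link_ok (w : W) : bool := [set w; L w] \notin F.

Lemma at_copy_inj a : injective (at_copy a). Proof. by move=> x y []. Qed.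

Lemma at_copy2 a x y : at_copy a @: [set x; y] = [set (a, x); (a, y)].
Proof. by rewrite imsetU1 imset_set1. Qed.

Lemma mem_at_copy a (S : {set V}) w : (w \in at_copy a @: S) = (w.1 == a) && (w.2 \in S).
Proof.
apply/imsetP/andP=> [[x xS ->]|[/eqP <- wS]]; first by rewrite eqxx.
by exists w.2 => //; case: (w).
Qed.

Lemma liveW_sym : symmetric lW.
Proof. by apply: live_sym copies_sym. Qed.

Lemma layer_live a x y : live A (layer a) x y = lW (a, x) (a, y).
Proof. by rewrite /live copies_inner inE at_copy2. Qed.

Lemma layer_edge_set a : edge_set A (layer a).
Proof.
move=> f; rewrite inE => fF; have [[b x] [[b' y] [xy fE]]] := eF fF.
have : (b, x) \in at_copy a @: f by rewrite fE set21.
have : (b', y) \in at_copy a @: f by rewrite fE set22.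
move=> /imsetP[y' _ [? _]] /imsetP[x' _ [? _]]; subst.
exists x, y; split; first by rewrite -(copies_inner a).
by apply: (imset_inj (@at_copy_inj a)); rewrite at_copy2.
Qed.

Lemma link_okL w : link_ok (L w) = link_ok w.
Proof. by rewrite /link_ok LK setUC. Qed.

Lemma live_link w : lW w (L w) = link_ok w.
Proof. by rewrite /live copies_link. Qed.

Lemma layer_matchable a S :
  matchable (live A (layer a)) S -> matchable lW (at_copy a @: S).
Proof.
move=> /matchableP[m mP]; apply/matchableP; exists (fun w => (a, m w.2)).
move=> _ /imsetP[x /mP[mx mm em] ->] /=; split; last by rewrite -layer_live.
  by apply/imsetP; exists (m x).
by rewrite mm.
Qed.

(* [X] collects the vertices of the copies in [U] that are still to be matched
   to vertices of other copies. *)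
Definition partial_matching U X : bool :=
  (X \subset copies U) && matchable lW (copies U :\: X).

Lemma partial_start i (X : {set V}) :
  matchable (live A (layer i)) (~: X) -> partial_matching [set i] (at_copy i @: X).
Proof.
move=> /layer_matchable mX; apply/andP; split.
  by apply/subsetP=> _ /imsetP[x _ ->]; rewrite !inE.
suff <- : at_copy i @: (~: X) = copies [set i] :\: at_copy i @: X by [].
apply/setP=> w; rewrite !inE !mem_at_copy !inE andbC.
by case: (w.1 == i); rewrite ?andbF ?andbT.
Qed.

(** The exposed vertex [x] is matched along its link into the new copy [a], and [(a, q)] becomes
    exposed in its place. *)
Lemma partial_extend U X x q (a := (L x).1) :
    partial_matching U X -> x \in X -> a \notin U -> link_ok x ->
    q != (L x).2 -> matchable (live A (layer a)) (~: [set (L x).2; q]) ->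
  partial_matching (a |: U) ((a, q) |: X :\ x).
Proof.
case/andP=> /subsetP XU mX xX aU okx qx /layer_matchable ma.
have xU : x.1 \in U by have := XU x xX; rewrite inE.
apply/andP; split.
  apply/subsetP=> w; rewrite !inE => /orP[/eqP->|/andP[_ /XU]]; rewrite ?eqxx //.
  by rewrite inE => ->; rewrite orbT.
have -> : copies (a |: U) :\: ((a, q) |: X :\ x)
    = x |: (L x |: (copies U :\: X :|: at_copy a @: ~: [set (L x).2; q])).
  have pairE (w v : W) : (w == v) = (w.1 == v.1) && (w.2 == v.2).
    by case: w v => [? ?] [? ?].
  apply/setP=> w; rewrite !inE mem_at_copy !inE (pairE _ (a, q)) (pairE _ (L x)) /=.
  have [wa|wa] /= := eqVneq w.1 a.
    have wU : (w.1 \in U) = false by rewrite wa (negPf aU).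
    have wX : (w \in X) = false by apply: contraFF wU => /XU; rewrite inE.
    have wx : (w == x) = false by apply: contraFF wU => /eqP->.
    rewrite wX wx wU andbF !orbF andbT /=.
    have [->|_] /= := eqVneq w.2 q; first by rewrite (negPf qx).
    by case: (w.2 == _).
  by rewrite orbF; have [->|wx] := eqVneq w x; rewrite ?xU.
apply: matchableU2; rewrite ?live_link //; first exact: liveW_sym.
- by rewrite eq_sym; apply: contraNneq (L_neq x) => ->.
- by rewrite in_setU in_setD xX mem_at_copy /= eq_sym (negPf (L_neq x)).
- by rewrite in_setU in_setD mem_at_copy !inE eqxx (negPf aU) !andbF.
apply: matchableU => //; rewrite disjoints_subset; apply/subsetP=> w.
rewrite !inE mem_at_copy => /andP[_ wU]; apply: contraNN aU => /andP[/eqP<- _] //.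
Qed.

Lemma partial_close U X x :
    partial_matching U X -> x \in X -> L x \in X -> link_ok x ->
  partial_matching U (X :\ x :\ L x).
Proof.
case/andP=> /subsetP XU mX xX LxX okx; apply/andP; split.
  by apply/subsetP=> w; rewrite !inE => /and3P[_ _ /XU]; rewrite inE.
have -> : copies U :\: (X :\ x :\ L x) = x |: (L x |: (copies U :\: X)).
  apply/setP=> w; have := XU x xX; have := XU _ LxX; rewrite !inE => LxU xU.
  have [->|wx] /= := eqVneq w x; first by rewrite xU andbF.
  by have [->|wLx] /= := eqVneq w (L x); rewrite ?LxU.
apply: matchableU2; rewrite ?live_link ?inE ?xX ?LxX //; first exact: liveW_sym.
by rewrite eq_sym; apply: contraNneq (L_neq x) => ->.
Qed.

Lemma partial_fill U X :
    partial_matching U X ->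
    (forall a, a \notin U -> matchable (live A (layer a)) setT) ->
  matchable lW (~: X).
Proof.
case/andP=> /subsetP XU /matchableP[m mP] others.
(* One involution is chosen for every copy at once; inside [U] the value [id] is only a default. *)
have /fin_all_exists[m' m'P] a : exists m' : V -> V, a \notin U -> forall x,
    m' (m' x) = x /\ live A (layer a) x (m' x).
  case: (boolP (a \in U)) => [aU|/others/matchableP[m' m'P]]; first by exists id.
  by exists m' => _ x; have [] := m'P x; rewrite ?inE.
apply/matchableP; exists (fun w => if w.1 \in U then m w else (w.1, m' w.1 w.2)).
move=> w; rewrite inE => wX; case: ifP => wU.
  have wS : w \in copies U :\: X by rewrite !inE wX.
  have [+ mm em] := mP w wS.
  by rewrite !inE => /andP[mX mU]; rewrite mU.
have [mm em] := m'P _ (negbT wU) w.2; rewrite /= wU inE.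
rewrite mm; split; first by apply/negP=> /XU; rewrite inE /= wU.
  by case: (w).
by rewrite layer_live in em; case: (w) em.
Qed.

(** * Distribution of the faults over the copies *)

Definition inner a : {set {set W}} := [set f in F | f \subset copies [set a]].

Definition touched : {set I} := fst @: cover F.

Lemma card_touched : #|touched| <= 2 * #|F|.
Proof.
apply: leq_trans (leq_imset_card _ _) _; apply: leq_trans (leq_card_cover F) _.
rewrite mulnC -sum_nat_const; apply: leq_sum => f /eF[x [y [_ ->]]].
by rewrite cards2; case: eqP.
Qed.

Lemma fault_touched f w : f \in F -> w \in f -> w.1 \in touched.
Proof. by move=> fF wf; apply: imset_f; apply/bigcupP; exists f. Qed.

Lemma untouched_layer a : a \notin touched -> layer a = set0.
Proof.
move=> aF; apply/setP=> f; rewrite in_set0; apply: contraNF aF => fa.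
have [x [y [_ fE]]] := layer_edge_set fa.
move: fa; rewrite inE => fF; apply: (@fault_touched _ (a, x) fF).
by rewrite mem_at_copy /= eqxx fE set21.
Qed.

Lemma untouched_link w : w.1 \notin touched -> link_ok w.
Proof. by apply: contra => /fault_touched; apply; rewrite set21. Qed.

Lemma clean_matchable a x y :
  layer a = set0 -> x != y -> matchable (live A (layer a)) (~: [set x; y]).
Proof.
move=> -> /bicA; apply: matchable_sub => u v _ _.
by rewrite /live inE andbT.
Qed.

Lemma inner_edge f a : f \in F -> f \subset copies [set a] ->
  exists x y, f = [set (a, x); (a, y)].
Proof.
move=> /eF[[b x] [[b' y] [_ ->]]]; rewrite subUset !sub1set !inE /=.
by move=> /andP[/eqP-> /eqP->]; exists x, y.
Qed.

Lemma link_notin_copy w a : ~~ ([set w; L w] \subset copies [set a]).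
Proof.
rewrite subUset !sub1set !inE; apply/negP=> /andP[/eqP wa /eqP Lwa].
by have := L_neq w; rewrite wa Lwa eqxx.
Qed.

Lemma card_layer a : #|layer a| <= #|inner a|.
Proof.
rewrite -(card_imset (mem (layer a)) (imset_inj (@at_copy_inj a))).
apply: subset_leq_card; apply/subsetP=> _ /imsetP[f + ->].
rewrite !inE => -> /=; apply/subsetP=> w.
by rewrite mem_at_copy !inE => /andP[].
Qed.

Lemma card_layerD (G : {set {set W}}) a :
  inner a \subset G -> #|layer a| + #|G :\: inner a| <= #|G|.
Proof.
by move=> aG; rewrite -(cardsID (inner a) G) leq_add2r (setIidPr aG) card_layer.
Qed.

Lemma inner_sub a : inner a \subset F.
Proof. by apply/subsetP=> f; rewrite inE => /andP[]. Qed.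

Lemma inner_subD (G : {set {set W}}) a b :
  a != b -> inner b \subset G -> inner b \subset G :\: inner a.
Proof.
move=> ab bG; apply/subsetP=> f fb; rewrite in_setD (subsetP bG) // andbT.
move: fb; rewrite !inE => /andP[fF fb]; rewrite fF /=.
have [x [y ->]] := inner_edge fF fb.
by rewrite subUset !sub1set !inE eq_sym (negPf ab).
Qed.

Lemma card_two_layers a b :
  a != b -> #|layer a| + #|layer b| + #|F :\: inner a :\: inner b| <= #|F|.
Proof.
move=> ab; apply: leq_trans (card_layerD (inner_sub a)).
by rewrite -addnA leq_add2l card_layerD ?inner_subD ?inner_sub.
Qed.

(** Vertices through which copy [a] should not be left: the link is faulty, or it leads into a copy
    with a fault. *)
Definition blocked a x : {set V} :=
  [set q | q != x & ~~ (link_ok (a, q) && (layer (L (a, q)).1 == set0))].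

(** A blocked exit is charged to its own link or to a fault of its target copy. Distinct exits have
    distinct targets, so the charges differ, and none lies in the two copies joined by the link of
    [w]. *)
Lemma card_blocked w :
  #|blocked w.1 w.2| <= #|F :\: inner w.1 :\: inner (L w).1|.
Proof.
set a := w.1; set b := (L w).1.
have ab : a != b by rewrite eq_sym L_neq.
have tgt q q' : (L (a, q)).1 = (L (a, q')).1 -> q = q'.
  by move/(@link_unique (a, q) (a, q') erefl) => [].
have tgtb q : q != w.2 -> (L (a, q)).1 != b.
  apply: contraNneq => h; have := @link_unique (a, q) w erefl h.
  by move=> <-.
(* The empty set is contained in every copy, so it has to be excluded for [R] to determine [q]. *)
pose R (f : {set W}) q := (f == [set (a, q); L (a, q)]) ||
  (f != set0) && (f \subset copies [set (L (a, q)).1]).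
apply: (card_le_rel (R := R)).
  have mix q q' : [set (a, q); L (a, q)] \subset copies [set (L (a, q')).1] -> q = q'.
    rewrite subUset !sub1set !inE /= => /andP[/eqP h _].
    by have := L_neq (a, q'); rewrite -h eqxx.
  move=> f q q' /orP[/eqP->|/andP[f0 fq]] /orP[].
  - case/eqP/set2_eq=> -[h _]; first by case: h.
    by have := L_neq (a, q'); rewrite -h eqxx.
  - by case/andP=> _ /mix.
  - by move=> /eqP fE; rewrite fE in fq; rewrite (mix _ _ fq).
  - case/andP=> _ fq'; have /set0Pn[v vf] := f0.
    have := subsetP fq v vf; have := subsetP fq' v vf; rewrite !inE.
    by move=> /eqP h /eqP; rewrite h => /tgt.
move=> q; rewrite inE negb_and => /andP[qw]; case/orP=> [|/set0Pn[f]].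
  rewrite negbK => fF; exists [set (a, q); L (a, q)]; last by rewrite /R eqxx.
  by rewrite !inE fF !link_notin_copy.
move=> fl; have [x [y [_ fE]]] := layer_edge_set fl.
move: fl; rewrite inE => fF; set b' := (L (a, q)).1 in fF *.
have xf : (b', x) \in at_copy b' @: f by rewrite mem_at_copy fE /= eqxx set21.
exists (at_copy b' @: f).
  rewrite !inE fF andbT; apply/andP; split; apply/negP=> /andP[_ /subsetP/(_ _ xf)].
    by rewrite !inE; apply/negP/tgtb.
  by rewrite !inE; apply/negP/L_neq.
apply/orP; right; rewrite fE at_copy2 subUset !sub1set !inE /= !eqxx !andbT.
by apply/set0Pn; exists (b', x); rewrite set21.
Qed.

(* The two exposed vertices are joined through their target copies and, when
   these differ, through a third copy that meets no fault. *)
Lemma partial_join U Z X x y :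
    partial_matching U X -> x \in X -> y \in X -> x != y ->
    link_ok x -> link_ok y -> layer (L x).1 = set0 -> layer (L y).1 = set0 ->
    [disjoint [set (L x).1; (L y).1] & U :|: Z] -> [disjoint U & Z] ->
    #|U| + #|Z| + 2 * #|F| + 2 < #|I| ->
  exists U', [/\ partial_matching U' (X :\ x :\ y), U \subset U',
                 [disjoint U' & Z] & #|U'| <= #|U| + 3].
Proof.
move=> pm; have /andP[/subsetP XU _] := pm.
move=> xX yX xy okx oky clx cly.
rewrite disjoints_subset subUset !sub1set !inE !negb_or.
move=> /andP[/andP[xU' xZ] /andP[yU' yZ]] dUZ cI.
have [xU yU] : x.1 \in U /\ y.1 \in U by split; [have := XU x xX|have := XU y yX]; rewrite inE.
have Lxy : L x != L y by rewrite (inj_eq (inv_inj LK)).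
have LX z : z \in X -> (L z).1 \notin U -> L z \notin X.
  by move=> _; apply: contra => /XU; rewrite inE.
(* With a common target copy, one clean copy missing both entry vertices is enough. *)
have [xyE|xy1] := eqVneq (L x).1 (L y).1.
  have q2 : (L y).2 != (L x).2.
    apply: contra_neq Lxy => h; rewrite [L x]surjective_pairing xyE -h.
    by case: (L y).
  have pm1 := partial_extend pm xX xU' okx q2 (clean_matchable clx _).
  rewrite eq_sym q2 in pm1; have {pm1} pm1 := pm1 isT.
  have Ly : ((L x).1, (L y).2) = L y by rewrite xyE; case: (L y).
  rewrite Ly in pm1; exists ((L x).1 |: U); split.
  - have := partial_close (x := L y) pm1; rewrite LK link_okL oky !inE eqxx /=.
    rewrite yX [y == x]eq_sym (negPf xy) orbT => /(_ isT isT isT).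
    congr partial_matching; apply/setP=> z; rewrite !inE.
    have [->|zy] //= := eqVneq z y.
    have [->|zLy] //= := eqVneq z (L y).
    by rewrite (negPf (LX _ yX yU')) andbF.
  - exact: subsetUr.
  - by rewrite disjoints_subset subUset sub1set inE xZ -disjoints_subset.
  - by rewrite cardsU1 addnC leq_add2l; case: (_ \notin _).
have xa : x.1 != (L x).1 by apply: contraNneq xU' => <-.
have yb : y.1 != (L y).1 by apply: contraNneq yU' => <-.
(* The third copy [e] avoids [U], [Z], the two targets and the at most [2 * #|F|] copies that meet a
   fault. *)
have /set0Pn[e] : ~: (U :|: Z :|: touched :|: [set (L x).1; (L y).1]) != set0.
  rewrite -card_gt0 card_setN subn_gt0; apply: leq_ltn_trans cI.
  apply: leq_trans (leq_card_setU _ _) _; rewrite leq_add //; last first.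
    by rewrite cards2; case: eqP.
  apply: leq_trans (leq_card_setU _ _) _; rewrite leq_add ?card_touched //.
  exact: leq_card_setU.
rewrite !inE !negb_or => /andP[/andP[/andP[eU eZ] et] /andP[ea eb]].
have cle := untouched_layer et.
rewrite eq_sym in ea; rewrite eq_sym in eb.
(* The vertex where a copy is entered leads back to the previous copy, so it is not the exit towards
   another one. *)
have port w z : w.1 != z -> p (L w).1 z = (L w).2 -> (L w).1 != z -> False.
  move=> wz h Lz; have := Lp Lz; rewrite h -surjective_pairing LK => wE.
  by rewrite wE eqxx in wz.
have xe : x.1 != e by apply: contraNneq eU => <-.
have ye : y.1 != e by apply: contraNneq eU => <-.
have q1 : p (L x).1 e != (L x).2 by apply/eqP=> /(port _ _ xe)/(_ ea).
have pm1 : partial_matching ((L x).1 |: U) (((L x).1, p (L x).1 e) |: X :\ x).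
  by apply: partial_extend => //; apply: clean_matchable; rewrite // eq_sym.
set x1 := ((L x).1, _) in pm1; set U1 := _ |: U in pm1.
have Lx1 : L x1 = (e, p e (L x).1) by rewrite Lp.
have Lx1_1 : (L x1).1 = e by rewrite Lx1.
have okx1 : link_ok x1 by rewrite -link_okL untouched_link // Lx1.
have q2 : p e (L y).1 != (L x1).2.
  rewrite Lx1 /=; apply/eqP=> h; have eb' : e != (L y).1 by rewrite eq_sym.
  have := Lp eb'; rewrite h Lp 1?eq_sym // => -[h1 _].
  by rewrite h1 eqxx in xy1.
have eU1 : (L x1).1 \notin U1 by rewrite Lx1 !inE negb_or eq_sym ea.
have pm2 : partial_matching (e |: U1) ((e, p e (L y).1) |: (x1 |: X :\ x) :\ x1).
  have := partial_extend pm1 (setU11 _ _) eU1 okx1 q2; rewrite Lx1_1.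
  by apply; apply: clean_matchable; rewrite // eq_sym.
set x2 := (e, _) in pm2; set U2 := _ |: U1 in pm2.
have Lx2 : L x2 = ((L y).1, p (L y).1 e) by rewrite Lp // eq_sym.
have Lx2_1 : (L x2).1 = (L y).1 by rewrite Lx2.
have okx2 : link_ok x2 by rewrite untouched_link.
have q3 : (L y).2 != (L x2).2.
  by rewrite Lx2 eq_sym; apply/eqP=> /(port _ _ ye)/(_ eb).
have bU2 : (L x2).1 \notin U2.
  by rewrite Lx2 !inE !negb_or eb eq_sym xy1.
have pm3 := partial_extend pm2 (setU11 _ _) bU2 okx2 q3.
rewrite Lx2_1 -surjective_pairing in pm3.
have {}pm3 := pm3 (clean_matchable cly _).
rewrite eq_sym q3 in pm3; have {}pm3 := pm3 isT.
exists ((L y).1 |: U2); split.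
- have := partial_close (x := L y) pm3; rewrite LK link_okL oky !inE eqxx /=.
  have x1X : x1 \notin X by apply: contra xU' => /XU; rewrite inE.
  have x2X : x2 \notin X by apply: contra eU => /XU; rewrite inE.
  have yx2 : y != x2 by apply: contraNneq x2X => <-.
  have yx1 : y != x1 by apply: contraNneq x1X => <-.
  rewrite yX [y == x]eq_sym (negPf xy) yx2 yx1 !orbT => /(_ isT isT isT).
  congr partial_matching; apply/setP=> z; rewrite !inE.
  have [->|zy] //= := eqVneq z y.
  have [->|zLy] /= := eqVneq z (L y).
    by rewrite (negPf (LX _ yX yU')) andbF.
  have [->|zx2] /= := eqVneq z x2; first by rewrite (negPf x2X) andbF.
  by have [->|zx1] //= := eqVneq z x1; rewrite (negPf x1X) andbF.
- by rewrite /U2 /U1 !setUA subsetUr.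
- by rewrite disjoints_subset !subUset !sub1set !inE yZ eZ xZ -disjoints_subset.
- rewrite /U2 /U1 !cardsU1 !addnA addnC leq_add2l.
  by do 3!case: (_ \notin _).
Qed.

(** * Faults that preclude perfect matchings *)

Section Preclusion.

Hypotheses (d3 : 2 < d) (dV : d.+1 < #|V|) (cI : 4 * d + 6 < #|I|).
Hypothesis qA : square_free A.
Hypothesis resilient : forall H, edge_set A H -> #|H| <= 2 * d - 3 ->
  (forall x, exists y, live A H x y) -> matchable (live A H) setT.
Hypothesis cF : #|F| <= 2 * d.
Hypothesis no_isolated : forall w, exists z, lW w z.
Hypothesis no_perfect : ~~ matchable lW setT.

(** Both [u] and [w] can then be matched only to [v], so this is an obstruction in itself; it is the
    edge set of a trivial solution, contained in [F]. *)
Definition twin_stars : Prop := exists u v w,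
  [/\ u != w, AW u v, AW v w,
      forall z, AW u z -> z != v -> [set u; z] \in F
    & forall z, AW w z -> z != v -> [set w; z] \in F].

(** The links alone form a perfect matching, so they cannot all survive. *)
Lemma link_fault : exists w, ~~ link_ok w.
Proof.
apply/existsP; apply: contraR no_perfect; rewrite negb_exists => /forallP ok.
apply/matchableP; exists L => w _; rewrite inE LK; split=> //.
by rewrite live_link; apply: negbNE (ok w).
Qed.

Lemma live_cases w : exists z, lW w z /\ (L w = z /\ link_ok w \/
  w.1 = z.1 /\ A w.2 z.2 /\ [set w.2; z.2] \notin layer w.1).
Proof.
have [z wz] := no_isolated w; exists z; split=> //.
have /andP[] := wz; rewrite AWE => /orP[/andP[/eqP h Awz]|/eqP h] nF; last first.
  by left; rewrite /link_ok h.
right; split=> //; split=> //; rewrite inE at_copy2 -surjective_pairing h.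
by rewrite -surjective_pairing.
Qed.

Lemma bad_copy : exists i, ~~ matchable (live A (layer i)) setT.
Proof.
apply/existsP; apply: contraR no_perfect; rewrite negb_exists => /forallP ok.
have pm0 : partial_matching set0 set0.
  rewrite /partial_matching sub0set setD0 (_ : copies _ = set0) ?matchable0 //.
  by apply/setP=> w; rewrite !inE.
by have := partial_fill pm0 (fun a _ => negbNE (ok a)); rewrite setC0.
Qed.

Lemma matchable_layer a : #|layer a| < d -> matchable (live A (layer a)) setT.
Proof. exact: (matchable_few colA). Qed.

(** * The copy without a perfect matching *)

Section BadCopy.

Variable i : I.
Hypothesis bad : ~~ matchable (live A (layer i)) setT.

Lemma bad_layer : d <= #|layer i|.
Proof. by rewrite leqNgt; apply: contra bad => /matchable_layer. Qed.

Lemma link_outer w a b : ~~ link_ok w ->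
  [set w; L w] \in F :\: inner a :\: inner b.
Proof. by move/negbNE=> wF; rewrite !inE wF !(negPf (link_notin_copy _ _)). Qed.

Lemma outer_gt0 a b : 0 < #|F :\: inner a :\: inner b|.
Proof.
by have [w /(link_outer a b) wF] := link_fault; apply/card_gt0P; eexists; apply: wF.
Qed.

(** Copy [i] takes at least [d] of the [2 * d] faults and some link takes one, so fewer than [d] are
    left for copy [a] and some colour class survives there. *)
Lemma other_copy a : a != i -> matchable (live A (layer a)) setT.
Proof.
rewrite eq_sym => /card_two_layers h; apply: matchable_layer.
move: bad_layer cF h (outer_gt0 i a) d3.
do !move: #|_|; clear; lia.
Qed.

Lemma no_full U : partial_matching U set0 -> i \notin U.
Proof.
move=> pm; apply: contra no_perfect => iU; rewrite -setC0.
by apply: (partial_fill pm) => a aU; apply: other_copy; apply: contraNneq aU => ->.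
Qed.

Lemma target_inj a x y : (L (a, x)).1 = (L (a, y)).1 -> x = y.
Proof. by move/(@link_unique (a, x) (a, y) erefl) => []. Qed.

Lemma partial_start2 u w : matchable (live A (layer i)) (~: [set u; w]) ->
  partial_matching [set i] [set (i, u); (i, w)].
Proof. by move/partial_start; rewrite at_copy2. Qed.

(** From [u] the path enters copy [a], which may have faults, and leaves it at [q]; [partial_join]
    then connects [(a, q)] with [(i, w)] through clean copies. All copies outside the path are
    matchable, so a perfect matching results. *)
Lemma route u w q (a := (L (i, u)).1) (u' := (L (i, u)).2) :
    u != w -> matchable (live A (layer i)) (~: [set u; w]) ->
    link_ok (i, u) -> link_ok (i, w) -> layer (L (i, w)).1 = set0 ->
    q != u' -> q \notin blocked a u' ->
    matchable (live A (layer a)) (~: [set u'; q]) ->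
  False.
Proof.
move=> uw /partial_start2 pm oku okw clw qu' + mq.
rewrite inE qu' /= negbK => /andP[okq /eqP clq].
have LE : L (a, u') = (i, u) by rewrite /a /u' -surjective_pairing LK.
have ai : a != i := L_neq (i, u).
have aU : a \notin [set i] by rewrite inE.
have pm1 := partial_extend pm (set21 _ _) aU oku qu' mq.
have wX : (i, w) \in (a, q) |: [set (i, u); (i, w)] :\ (i, u).
  by apply/setU1P; right; apply/setD1P; rewrite set22 xpair_eqE eqxx eq_sym.
have qw : (a, q) != (i, w) by rewrite xpair_eqE (negPf ai).
have tq : (L (a, q)).1 != i.
  apply: contra_neq qu' => h; apply: (@target_inj a); rewrite LE //.
have tw : (L (i, w)).1 != a by apply: contra_neq uw => /target_inj.
have dsj : [disjoint [set (L (a, q)).1; (L (i, w)).1] & (a |: [set i]) :|: set0].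
  rewrite setU0 disjoints_subset subUset !sub1set !inE !negb_or tq tw.
  by rewrite (L_neq (a, q)) (L_neq (i, w)).
have dU0 : [disjoint a |: [set i] & (set0 : {set I})].
  by rewrite disjoint_sym disjoints_subset sub0set.
have cI' : #|a |: [set i]| + #|(set0 : {set I})| + 2 * #|F| + 2 < #|I|.
  rewrite cards2 cards0; move: cI cF; case: (a != i); do !move: #|_|; clear; lia.
have [U [pmU sU _ _]] := partial_join pm1 (setU11 _ _) wX qw okq okw clq clw dsj dU0 cI'.
have : i \notin U.
  apply: no_full; move: pmU; congr partial_matching; apply/setP=> z; rewrite !inE.
  by case: (z == (i, w)); case: (z == (a, q)); case: (z == (i, u)).
by move/negP; apply; apply: (subsetP sU); rewrite !inE eqxx orbT.
Qed.

(** The [d] faults at [u] leave only its link, so [u] has to be one of the exposed vertices. At most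
    [d] other faults remain to hinder the second exposed vertex [w] in copy [i] and the exit [q] in
    copy [a], both obtained from [exit_exists]. *)
Lemma isolated_case u : (forall y, A u y -> [set u; y] \in layer i) -> twin_stars.
Proof.
move=> uH.
have oku : link_ok (i, u).
  have [z [_ [[//]|]]] := live_cases (i, u).
  by case=> _ [] /= /uH ->.
set a := (L (i, u)).1; set u' := (L (i, u)).2.
have LE : L (a, u') = (i, u) by rewrite /a /u' -surjective_pairing LK.
have ia : i != a by rewrite eq_sym; apply: (L_neq (i, u)).
have c2 := card_two_layers ia; have O0 := outer_gt0 i a.
have starH : star A u \subset layer i.
  by apply/subsetP=> f /starP[y /uH ? ->].
have cH : #|layer i| = d + #|[set f in layer i | u \notin f]|.
  rewrite -(card_star colA u) -(cardsID (star A u)) (setIidPr starH); congr addn.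
  apply: eq_card => f; rewrite !inE andbC; case: (boolP (at_copy i @: f \in F)) => //= fF.
  congr (~~ _); apply/idP/idP=> [/starP[y _ ->]|]; first by rewrite set21.
  by apply: (star_mem sA (@layer_edge_set i)); rewrite inE.
(* A single fault outside the two copies has to be a link; a blocked exit is then
   blocked by its own link. *)
have only_link b : #|F :\: inner i :\: inner a| <= 1 -> b != i -> b != a ->
    layer b = set0.
  move=> O1 bi ba; apply/eqP/set0Pn=> -[f fb].
  have [x [y [_ fE]]] := layer_edge_set fb.
  have [w0 ok0] := link_fault; have w0O := link_outer i a ok0.
  have bO : at_copy b @: f \in F :\: inner i :\: inner a.
    move: fb; rewrite !inE fE at_copy2 => ->; rewrite !subUset !sub1set !inE /=.
    by rewrite (negPf bi) (negPf ba).
  have [w1 O1E] : exists w1, F :\: inner i :\: inner a = [set w1].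
    by apply/cards1P; rewrite eqn_leq O1.
  move: bO w0O; rewrite O1E !inE => /eqP<- /eqP h.
  have := link_notin_copy w0 b; rewrite h fE at_copy2 subUset !sub1set !inE /=.
  by rewrite eqxx.
have blockedP w r : #|F :\: inner i :\: inner a| <= 1 ->
    w \in [set (i, u); (a, u')] -> r \in blocked w.1 w.2 -> ~~ link_ok (w.1, r).
  move=> O1 wE; rewrite inE negb_and => /andP[rw /orP[//|]].
  have tp : (L (w.1, r)).1 != (L w).1.
    by apply: contra_neq rw => /(@link_unique (w.1, r) w erefl) <-.
  have tn := L_neq (w.1, r).
  case/negP; apply/eqP/only_link => //.
    move: wE tp tn; rewrite !inE => /orP[]/eqP-> //=; rewrite LE //.
  by move: wE tp tn; rewrite !inE => /orP[]/eqP-> //=.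
have hw : exists w, [/\ w != u, w \notin blocked i u
                  & matchable (live A (layer i)) (~: [set u; w])].
  have bc := card_blocked (i, u).
  have h1 : #|[set f in layer i | u \notin f]| <= d.-1.
    move: cH c2 O0 cF d3; do !move: #|_|; clear; lia.
  have h2 : #|blocked i u| <= d - #|[set f in layer i | u \notin f]|.
    apply: leq_trans bc _; move: cH c2 O0 cF d3; rewrite -/a.
    do !move: #|_|; clear; lia.
  (* The bad case is impossible in copy [i]: the link of [r] and all its inner edges, including the
     one to [u], would be faulty, so [r] would be isolated. *)
  have [//|[r [ur rB hr rH]]] := exit_exists sA iA colA qA bicA dV h1 h2.
  have O1 : #|F :\: inner i :\: inner a| <= 1.
    move: cH c2 hr cF d3; do !move: #|_|; clear; lia.
  have nok := blockedP (i, u) r O1 (set21 _ _) rB.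
  have [z [_ [[_]|]]] := live_cases (i, r); first by rewrite (negPf nok).
  case=> /= _ [pz]; have [->|zu] := eqVneq z.2 u.
    by rewrite setUC uH.
  by have := rH z.2 pz zu; rewrite inE => /andP[->].
have [w [wu wB mw]] := hw.
move: (wB); rewrite inE wu /= negbK => /andP[okw /eqP clw].
have bc := card_blocked (a, u'); rewrite LE /= in bc.
have {}bc : #|blocked a u'| <= #|F :\: inner i :\: inner a|.
  by rewrite setDDl setUC -setDDl.
have sub : #|[set f in layer a | u' \notin f]| <= #|layer a|.
  by apply: subset_leq_card; apply/subsetP=> f; rewrite inE => /andP[].
have h1 : #|[set f in layer a | u' \notin f]| <= d.-1.
  move: cH c2 O0 sub cF d3; do !move: #|_|; clear; lia.
have h2 : #|blocked a u'| <= d - #|[set f in layer a | u' \notin f]|.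
  apply: leq_trans bc _; move: cH c2 O0 sub cF d3; do !move: #|_|; clear; lia.
have [|[r [ur rB hr rH]]] := exit_exists sA iA colA qA bicA dV h1 h2.
  case=> q [qu qB mq]; exfalso.
  by apply: (route (u := u) (w := w) _ mw oku okw clw qu qB mq); rewrite eq_sym.
have O1 : #|F :\: inner i :\: inner a| <= 1.
  move: cH c2 hr sub cF d3; do !move: #|_|; clear; lia.
have nok := blockedP (a, u') r O1 (set22 _ _) rB.
have rHF y : A r y -> y != u' -> [set r; y] \in layer a.
  by move=> ry yu; have := rH y ry yu; rewrite inE => /andP[].
(* In copy [a] the bad case leaves [r] with no edge other than the one to [u'], which is also the
   only live neighbour of [u]. *)
exists (i, u), (a, u'), (a, r); split.
- by rewrite xpair_eqE (negPf ia).
- by rewrite -LE copies_sym copies_link.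
- by rewrite copies_inner.
- move=> z; rewrite AWE => /orP[/andP[/eqP /= h Az]|/eqP <-]; last first.
    by rewrite /a /u' -surjective_pairing eqxx.
  by move=> _; have := uH _ Az; rewrite inE at_copy2 h -surjective_pairing.
- move=> z; rewrite AWE => /orP[/andP[/eqP /= h Az]|/eqP <- _].
    move=> zu; have := rHF z.2 Az; rewrite inE at_copy2 {2}h -surjective_pairing.
    by apply; apply: contraNneq zu => <-; rewrite h -surjective_pairing.
  exact: negbNE nok.
Qed.

(** One of the two faults outside copy [i] is a link, so at most one lies inside another copy. Hence
    one of the two targets is clean, and the bad case of [exit_exists] in the other would need
    [d.-1], at least two, faults there. *)
Lemma few_outer x y : #|F :\: inner i| <= 2 -> x != y ->
    matchable (live A (layer i)) (~: [set x; y]) ->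
    link_ok (i, x) -> link_ok (i, y) ->
  False.
Proof.
move=> O2; wlog cly : x y / layer (L (i, y)).1 = set0 => [main|] xy mxy okx oky.
  have [|/set0Pn[g gy]] := eqVneq (layer (L (i, y)).1) set0.
    by move=> cly; apply: (main x y).
  apply: (main y x); rewrite 1?setUC 1?eq_sym //.
  apply/eqP/set0Pn=> -[f fx].
  have ix : i != (L (i, x)).1 by rewrite eq_sym; apply: (L_neq (i, x)).
  have iy : i != (L (i, y)).1 by rewrite eq_sym; apply: (L_neq (i, y)).
  have xy1 : (L (i, x)).1 != (L (i, y)).1 by apply: contra_neq xy => /target_inj.
  have := card_layerD (inner_subD ix (inner_sub _)).
  have := card_layerD (inner_subD xy1 (inner_subD iy (inner_sub _))).
  have [w /negbNE wF] := link_fault.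
  have : 0 < #|F :\: inner i :\: inner (L (i, x)).1 :\: inner (L (i, y)).1|.
    apply/card_gt0P; exists [set w; L w].
    by rewrite !inE wF !(negPf (link_notin_copy _ _)).
  have : 0 < #|layer (L (i, x)).1| by apply/card_gt0P; exists f.
  have : 0 < #|layer (L (i, y)).1| by apply/card_gt0P; exists g.
  by move: O2; do !move: #|_|; clear; lia.
set a := (L (i, x)).1; set x' := (L (i, x)).2.
have LE : L (a, x') = (i, x) by rewrite /a /x' -surjective_pairing LK.
have ia : i != a by rewrite eq_sym; apply: (L_neq (i, x)).
have bc := card_blocked (a, x'); rewrite LE /= in bc.
rewrite setDDl setUC -setDDl in bc.
have c2 := card_layerD (inner_subD ia (inner_sub _)); have O0 := outer_gt0 i a.
have sub : #|[set f in layer a | x' \notin f]| <= #|layer a|.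
  by apply: subset_leq_card; apply/subsetP=> f; rewrite inE => /andP[].
have h1 : #|[set f in layer a | x' \notin f]| <= d.-1.
  move: c2 O0 O2 sub d3; do !move: #|_|; clear; lia.
have h2 : #|blocked a x'| <= d - #|[set f in layer a | x' \notin f]|.
  apply: leq_trans bc _; move: c2 O0 O2 sub d3; do !move: #|_|; clear; lia.
have [|[r [_ _ hr _]]] := exit_exists sA iA colA qA bicA dV h1 h2.
  by case=> q [qx qB mq]; apply: (route xy mxy okx oky cly qx qB mq).
by move: hr c2 O0 O2 sub d3; do !move: #|_|; clear; lia.
Qed.

Lemma card_blocked_links :
  #|[set z | ~~ link_ok (i, z)]| <= #|F :\: inner i|.
Proof.
apply: (card_le_rel (R := fun f z => f == [set (i, z); L (i, z)])).
  move=> f x y /eqP-> /eqP/set2_eq[][]; first by case.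
  by move=> h; have := L_neq (i, y); rewrite -h eqxx.
move=> z; rewrite inE => /negbNE zF; exists [set (i, z); L (i, z)] => //.
by rewrite !inE zF (negPf (link_notin_copy _ _)).
Qed.

(** * The bad copy has no isolated vertex *)

Section NoIsolated.

Hypothesis live_neighbour : forall x, exists y, live A (layer i) x y.
Let Zs := [set z | ~~ link_ok (i, z)].
Let at_vertex z := [set f in layer i | z \in f].

Lemma at_vertex_sub z y : live A (layer i) z y ->
  at_vertex z \subset star A z :\ [set z; y].
Proof.
move=> /andP[_ zy]; apply/subsetP=> f; rewrite inE => /andP[fH zf].
rewrite in_setD1 (star_mem sA (@layer_edge_set i)) // andbT.
by apply: contraNneq zy => <-.
Qed.

Lemma card_star_minus z y : live A (layer i) z y ->
  #|star A z :\ [set z; y]| = d.-1.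
Proof.
move=> /andP[zy _]; have := cardsD1 [set z; y] (star A z).
have -> : [set z; y] \in star A z by apply/imsetP; exists y; rewrite ?inE.
rewrite (card_star colA); by move/(congr1 predn) => /= ->.
Qed.

Lemma card_at_vertex z : #|at_vertex z| <= d.-1.
Proof.
have [y zy] := live_neighbour z.
by rewrite -(card_star_minus zy); apply/subset_leq_card/at_vertex_sub.
Qed.

(** Each vertex keeps a live edge in copy [i], so it meets at most [d.-1] faults of that copy. *)
Lemma card_near_links :
  #|[set f in layer i | ~~ [disjoint f & Zs]]| <= #|Zs| * d.-1.
Proof.
apply: (@leq_trans #|\bigcup_(z in Zs) at_vertex z|).
  apply: subset_leq_card; apply/subsetP=> f; rewrite inE => /andP[fH].
  rewrite disjoint_sym => /pred0Pn[z /andP[zZ zf]]; apply/bigcupP; exists z => //.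
  by rewrite inE fH.
rewrite -sum_nat_const.
apply: (big_ind2 (fun (X : {set {set V}}) n => #|X| <= n)); rewrite ?cards0 //.
  by move=> X n Y m hX hY; apply: leq_trans (leq_card_setU _ _) (leq_add hX hY).
by move=> z _; apply: card_at_vertex.
Qed.

Lemma resilientD (H : {set {set V}}) : H \subset layer i -> #|H| <= 2 * d - 3 ->
  matchable (live A H) setT.
Proof.
move=> HS cH; apply: resilient => //; first exact: edge_set_sub HS (@layer_edge_set i).
move=> x; have [y xy] := live_neighbour x; exists y; exact: live_sub HS _ _ xy.
Qed.

Lemma outer_link_ok f x :
  f \in [set f in layer i | [disjoint f & Zs]] -> x \in f -> link_ok (i, x).
Proof.
by rewrite !inE => /andP[_ /disjointFr h] /h; rewrite inE => /negbFE.
Qed.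

Lemma remove_one f : #|F :\: inner i| <= 2 ->
    f \in [set f in layer i | [disjoint f & Zs]] ->
    matchable (live A (layer i)) (setT :\: f) -> False.
Proof.
move=> O2 /[dup] fH + mf; rewrite inE => /andP[fl _].
have [x [y [xy fE]]] := layer_edge_set fl.
have nxy : x != y by apply: contraTneq xy => ->; rewrite iA.
apply: (few_outer O2 nxy); first by rewrite -fE -setTD.
  by apply: outer_link_ok fH _; rewrite fE set21.
by apply: outer_link_ok fH _; rewrite fE set22.
Qed.

(** The only fault outside copy [i] is a link, so at least [d] faults of the copy avoid the vertex
    with a faulty link. Without two of these, [2 * d - 3] faults remain and [resilient] applies. If
    the matching uses both, four vertices are exposed and joined in two pairs. *)
Lemma remove_two : #|layer i| = 2 * d - 1 -> False.
Proof.
move=> cH; have cD := card_layerD (inner_sub i).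
have O1 : #|F :\: inner i| <= 1 by move: cD cF cH d3; do !move: #|_|; clear; lia.
have Z1 := leq_trans card_blocked_links O1.
have [f1 [f2 [f1H f2H f12]]] : exists f1 f2,
    [/\ f1 \in [set f in layer i | [disjoint f & Zs]],
        f2 \in [set f in layer i | [disjoint f & Zs]] & f1 != f2].
  have /card_gt1P[f1 [f2 [? ? ?]]] : 1 < #|[set f in layer i | [disjoint f & Zs]]|.
    have := card_near_links; rewrite -/Zs in Z1 *.
    have := cardsID [set f : {set V} | [disjoint f & Zs]] (layer i).
    rewrite -setIdE (_ : _ :\: _ = [set f in layer i | ~~ [disjoint f & Zs]]).
      rewrite cH; move: d3 Z1 => {cH cD}; case: #|Zs| => [|[|//]];
      do !move: #|_|; clear; lia.
    by apply/setP=> f; rewrite !inE andbC.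
  by exists f1, f2.
have [f1l f2l] : f1 \in layer i /\ f2 \in layer i.
  by move: f1H f2H; rewrite !inE => /andP[-> _] /andP[-> _].
have O2 : #|F :\: inner i| <= 2 by apply: leq_trans O1 _.
have f2l1 : f2 \in layer i :\ f1 by rewrite in_setD1 eq_sym f12.
have sub1 : layer i :\ f1 \subset layer i := subsetDl _ _.
have eH := @layer_edge_set i.
have eH1 := edge_set_sub sub1 eH.
have m12 : matchable (live A (layer i :\ f1 :\ f2)) setT.
  apply: resilientD; first exact: subset_trans (subsetDl _ _) sub1.
  have := cardsD1 f1 (layer i); have := cardsD1 f2 (layer i :\ f1).
  rewrite f1l f2l1 cH; do !move: #|_|; clear; lia.
have [m1|[_ m1]] := matchable_restore sA iA eH1 f2l1 m12.
  have [m|[_ m]] := matchable_restore sA iA eH f1l m1; first exact: (negP bad).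
  exact: (remove_one O2 f1H m).
have [m|[f12d m]] := matchable_restore sA iA eH f1l m1.
  exact: (remove_one O2 f2H m).
have clean b : b != i -> layer b = set0.
  rewrite eq_sym => ib; apply/eqP; rewrite -cards_eq0.
  have := card_layerD (inner_subD ib (inner_sub _)); have := outer_gt0 i b.
  by move: O1; do !move: #|_|; clear; lia.
have [x1 [y1 [xy1 f1E]]] := eH _ f1l.
have [x2 [y2 [xy2 f2E]]] := eH _ f2l.
have okx1 : link_ok (i, x1) by apply: outer_link_ok f1H _; rewrite f1E set21.
have oky1 : link_ok (i, y1) by apply: outer_link_ok f1H _; rewrite f1E set22.
have okx2 : link_ok (i, x2) by apply: outer_link_ok f2H _; rewrite f2E set21.
have oky2 : link_ok (i, y2) by apply: outer_link_ok f2H _; rewrite f2E set22.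
have n1 : x1 != y1 by apply: contraTneq xy1 => ->; rewrite iA.
have n2 : x2 != y2 by apply: contraTneq xy2 => ->; rewrite iA.
move: f12d; rewrite f1E f2E subUset !sub1set !inE !negb_or !andbT.
move=> /andP[/andP[nx1x2 nx1y2] /andP[ny1x2 ny1y2]].
have mX : matchable (live A (layer i)) (~: (f2 :|: f1)).
  by move: m; rewrite setDDl setTD.
have pm := partial_start mX; rewrite imsetU f1E f2E !at_copy2 in pm.
set X := _ :|: _ in pm; set t := fun x => (L (i, x)).1.
have tn x : t x != i := L_neq (i, x).
have tneq x y : x != y -> t x != t y by apply: contra_neq; apply: target_inj.
have X1 : [/\ (i, x1) \in X, (i, y1) \in X, (i, x2) \in X & (i, y2) \in X].
  by rewrite !inE !eqxx !orbT.
have ne (x y : V) : x != y -> (i, x) != (i, y) by rewrite xpair_eqE eqxx.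
case: X1 => Xx1 Xy1 Xx2 Xy2.
(* The targets of [x2] and [y2] are passed as [Z], so that the first join keeps them free for the
   second. *)
have dsj : [disjoint [set t x1; t y1] & [set i] :|: [set t x2; t y2]].
  rewrite disjoints_subset subUset !sub1set !inE !negb_or !tn.
  by rewrite !tneq.
have dU : [disjoint [set i] & [set t x2; t y2]].
  by rewrite disjoints_subset sub1set !inE negb_or ![i == _]eq_sym !tn.
have c1 : #|[set i]| + #|[set t x2; t y2]| + 2 * #|F| + 2 < #|I|.
  rewrite cards1 cards2; move: cI cF; case: (_ != _); do !move: #|_|; clear; lia.
have [U [pmU iU dUZ cU]] :=
  partial_join pm Xx1 Xy1 (ne _ _ n1) okx1 oky1 (clean _ (tn _)) (clean _ (tn _)) dsj dU c1.
have {}dsj : [disjoint [set t x2; t y2] & U :|: set0].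
  by rewrite setU0 disjoint_sym.
have {}dU : [disjoint U & (set0 : {set I})].
  by rewrite disjoint_sym disjoints_subset sub0set.
(* Here [U] has at most 1 + 3 copies and [2 * #|F|] is at most [4 * d]; this is the origin of the
   bound [4 * d + 6] on the number of copies. *)
have c2 : #|U| + #|(set0 : {set I})| + 2 * #|F| + 2 < #|I|.
  move: cU; rewrite cards1 cards0; move: cI cF; do !move: #|_|; clear; lia.
have X2 : (i, x2) \in X :\ (i, x1) :\ (i, y1).
  by rewrite !in_setD1 Xx2 !ne // eq_sym.
have Y2 : (i, y2) \in X :\ (i, x1) :\ (i, y1).
  by rewrite !in_setD1 Xy2 !ne // eq_sym.
have [U' [pmU' UU' _ _]] :=
  partial_join pmU X2 Y2 (ne _ _ n2) okx2 oky2 (clean _ (tn _)) (clean _ (tn _)) dsj dU c2.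
have : i \notin U'.
  apply: no_full; move: pmU'; congr partial_matching; apply/setP=> z; rewrite !inE.
  by case: (z == (i, x1)); case: (z == (i, x2)); case: (z == (i, y1)); case: (z == (i, y2)).
by move/negP; apply; apply: (subsetP UU'); rewrite -sub1set.
Qed.

(** At most two vertices of copy [i] have a faulty link. A fault away from them can be removed as
    before. Otherwise the [2 * d - 2] faults all meet these vertices, at most [d.-1] at each, so
    there are two of them, [z1] and [z2], each keeping a single live edge. *)
Lemma remove_one_or_twin : #|layer i| = 2 * d - 2 -> twin_stars.
Proof.
move=> cH; have cD := card_layerD (inner_sub i).
have O2 : #|F :\: inner i| <= 2 by move: cD cF cH d3; do !move: #|_|; clear; lia.
have Z2 : #|Zs| <= 2 := leq_trans card_blocked_links O2.
have eH := @layer_edge_set i.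
have [f fH|noH] := pickP [pred f in [set f in layer i | [disjoint f & Zs]]].
  exfalso; have fl : f \in layer i by move: fH; rewrite !inE => /andP[].
  have mf : matchable (live A (layer i :\ f)) setT.
    apply: resilientD; first exact: subsetDl.
    by have := cardsD1 f (layer i); rewrite fl cH; do !move: #|_|; clear; lia.
  have [m|[_ m]] := matchable_restore sA iA eH fl mf; first exact: (negP bad).
  exact: (remove_one O2 fH m).
have noHn (f : {set V}) : f \in layer i -> ~~ [disjoint f & Zs].
  move=> fl; apply/negP=> dj; have := noH f; rewrite /= in_set dj andbT.
  by move/negP; apply.
have nearH (f : {set V}) : f \in layer i -> exists2 z, z \in Zs & z \in f.
  by move/noHn; rewrite disjoint_sym => /pred0Pn[z /andP[zZ zf]]; exists z.
have HZ : #|layer i| <= #|Zs| * d.-1.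
  apply: leq_trans card_near_links; apply: subset_leq_card; apply/subsetP=> f fl.
  by rewrite in_set; apply/andP; split; last exact: noHn.
have /cards2P[z1 [z2 [z12 ZE]]] : #|Zs| == 2.
  rewrite eqn_leq Z2; move: HZ d3; rewrite cH; case: #|Zs| => [|[|//]]; clear; lia.
have nearH2 (f : {set V}) : f \in layer i -> (z1 \in f) || (z2 \in f).
  by case/nearH=> z; rewrite ZE !inE => /orP[]/eqP-> ->; rewrite ?orbT.
have cU : 2 * d - 2 <= #|at_vertex z1| + #|at_vertex z2|.
  rewrite -cH; apply: leq_trans (leq_card_setU _ _); apply: subset_leq_card.
  by apply/subsetP=> f fl; rewrite !inE; move: (fl); rewrite inE => -> /=; apply: nearH2.
have [v1 zv1] := live_neighbour z1; have [v2 zv2] := live_neighbour z2.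
have full z v : live A (layer i) z v -> d.-1 <= #|at_vertex z| ->
    forall y, A z y -> y != v -> [set z; y] \in layer i.
  move=> zv cz y zy yv.
  have /eqP zE : at_vertex z == star A z :\ [set z; v].
    by rewrite eqEcard at_vertex_sub // card_star_minus.
  have : [set z; y] \in at_vertex z.
    rewrite zE in_setD1; apply/andP; split; last by apply/imsetP; exists y; rewrite ?inE.
    by rewrite (inj_eq (@set2_inj _ z)).
  by rewrite inE => /andP[].
have full1 : forall y, A z1 y -> y != v1 -> [set z1; y] \in layer i.
  apply: full => //; move: cU (card_at_vertex z2) d3; do !move: #|_|; clear; lia.
have full2 : forall y, A z2 y -> y != v2 -> [set z2; y] \in layer i.
  apply: full => //; move: cU (card_at_vertex z1) d3; do !move: #|_|; clear; lia.
have ZP z : (z \in Zs) = (z == z1) || (z == z2) by rewrite ZE !inE.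
have noL z : z \in Zs -> [set (i, z); L (i, z)] \in F by rewrite inE => /negbNE.
have starW z v : z \in Zs ->
    (forall y, A z y -> y != v -> [set z; y] \in layer i) ->
    forall w, AW (i, z) w -> w != (i, v) -> [set (i, z); w] \in F.
  move=> zZ zf w; rewrite AWE => /orP[/andP[/eqP /= h Aw]|/eqP <- _]; last exact: noL.
  move=> wv; have := zf w.2 Aw; rewrite inE at_copy2 {2}h -surjective_pairing.
  by apply; apply: contraNneq wv => <-; rewrite h -surjective_pairing.
have [v12|v12] := eqVneq v1 v2.
  move: (zv1) (zv2) => /andP[Az1 _] /andP[Az2 _].
  exists (i, z1), (i, v1), (i, z2); split.
  - by rewrite xpair_eqE eqxx.
  - by rewrite copies_inner.
  - by rewrite copies_inner v12 sA.
  - by apply: starW; rewrite ?ZP ?eqxx.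
  - by apply: starW; rewrite ?ZP ?eqxx ?orbT // v12.
exfalso; case: (colA) => cK c_inj eP.
have /eP[j jd cz1] : A z1 v1 by case/andP: zv1.
(* A fault of colour [j] meets [z1] or [z2], and the edge of colour [j] at [z1]
   is not faulty. *)
have colj x : [set x; c j x] \in layer i -> x = z2 \/ c j x = z2.
  have nz1 : [set z1; v1] \notin layer i by case/andP: zv1.
  move=> xH; have := nearH2 _ xH; rewrite in_set2 (in_set2 z2) => /orP[]/orP[]/eqP h.
  - by rewrite -h cz1 (negPf nz1) in xH.
  - have xv : x = v1 by rewrite -cz1 h cK.
    by rewrite -h xv setUC (negPf nz1) in xH.
  - by left.
  - by right.
(* If the live edge at [z2] also has colour [j], class [j] has no fault and copy [i] is not bad. *)
have [cz2|cz2] := eqVneq (c j z2) v2.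
  apply: (negP bad); apply: (matchable_colour colA jd) => x _; split=> //.
  have nz2 : [set z2; c j z2] \notin layer i by rewrite cz2; case/andP: zv2.
  apply/negP=> xH; case: (colj x xH) => h; first by rewrite h (negPf nz2) in xH.
  by move: nz2; rewrite -h cK // setUC xH.
have v2c : v2 != c j z2 by rewrite eq_sym.
(* The only fault of colour [j] is the edge at [z2]; shifting along [z2 v2] discards it. Neither
   exposed vertex is [z1] or [z2], so both links survive. *)
apply: (@few_outer (c j z2) (c j v2)) => //.
- rewrite (colour_eq colA) //; apply: contraTneq zv2 => ->.
  by rewrite /live iA.
- apply: (matchable_shift sA iA colA) => // x xz xcz _ _; apply/negP=> /colj[] h.
    by rewrite h eqxx in xz.
  by move: xcz; rewrite -h cK // eqxx.
- apply: contraT => nok; have : c j z2 \in Zs by rewrite inE.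
  rewrite ZP => /orP[/eqP h|]; last by rewrite (negPf (colour_neq iA colA _ jd)).
  have z2v1 : z2 = v1 by rewrite -cz1 -h cK.
  move/andP: zv1 => [Az1 nz1]; move: (full2 z1); rewrite {1}z2v1 sA => /(_ Az1).
  rewrite setUC z2v1 (negPf nz1) -h => /(_ cz2); by [].
- apply: contraT => nok; have : c j v2 \in Zs by rewrite inE.
  rewrite ZP => /orP[]/eqP h.
    by move: v12; rewrite -cz1 -h cK // eqxx.
  by move: v2c; rewrite -h cK // eqxx.
Qed.

End NoIsolated.

End BadCopy.

Theorem preclusion_twin_stars : twin_stars.
Proof.
have [i bad] := bad_copy.
have [u /forallP uH|noiso] := pickP [pred u | [forall y, A u y ==> ([set u; y] \in layer i)]].
  by apply: (isolated_case bad (u := u)) => y; apply/implyP/uH.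
have live_nb x : exists y, live A (layer i) x y.
  have /= := noiso x => /negbT; rewrite negb_forall => /existsP[y].
  by rewrite negb_imply; exists y.
have cH : 2 * d - 3 < #|layer i|.
  rewrite ltnNge; apply: contra bad => cH.
  by apply: resilient => //; apply: layer_edge_set.
have cD := card_layerD (inner_sub i).
have O0 : 0 < #|F :\: inner i|.
  by apply: leq_trans (outer_gt0 i i) _; apply: subset_leq_card; apply: subsetDl.
have [/(remove_two bad live_nb)//|] := eqVneq #|layer i| (2 * d - 1).
move=> nH; apply: (remove_one_or_twin bad live_nb).
move: cH cD O0 nH cF d3; do !move: #|_|; clear; lia.
Qed.

End Preclusion.

End Faults.

(** * Bicriticality *)

(** With no fault at all, the machinery of partial matchings applies to [F = set0]. Vertices of
    different copies are handled by a path from the copy of [x] to that of [y] through a third copy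
    [e]. *)
Lemma copies_bicritical :
  0 < d -> 4 < #|I| -> bicritical A -> bicritical AW.
Proof.
move=> d0 cI bicA x y xy.
have e0 : edge_set AW set0 by move=> f; rewrite inE.
have l0 a S : matchable A S -> matchable (live A (layer set0 a)) S.
  by apply: matchable_sub => u v _ _ uv; rewrite /live uv !inE.
have fill U X : partial_matching set0 U X -> matchable AW (~: X).
  move=> pm; apply: (@matchable_sub _ (live AW set0)); first by move=> u v _ _ /andP[].
  apply: (partial_fill pm) => a _; apply: (matchable_few colA).
  by rewrite (_ : layer _ _ = set0) ?cards0 //; apply/setP=> f; rewrite !inE.
have ok w : link_ok set0 w by rewrite /link_ok inE.
have [xy1|xy1] := eqVneq x.1 y.1.
  have xy2 : x.2 != y.2.
    by apply: contra_neq xy => h; rewrite [x]surjective_pairing xy1 h; case: (y).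
  have := partial_start (l0 x.1 _ (bicA _ _ xy2)); rewrite at_copy2.
  have -> : (x.1, x.2) = x by case: (x).
  have -> : (x.1, y.2) = y by rewrite xy1; case: (y).
  exact: fill.
(* As [e] is not the target of [x] or [y], the vertices linked to [e] in their copies are other than
   [x] and [y]. *)
have /set0Pn[e] : ~: ([set x.1; y.1] :|: [set (L x).1; (L y).1]) != set0.
  rewrite -card_gt0 card_setN subn_gt0; apply: leq_ltn_trans cI.
  apply: leq_trans (leq_card_setU _ _) _.
  by rewrite !cards2; do 2!case: (_ != _).
rewrite !inE !negb_or => /andP[/andP[ex ey] /andP[eLx eLy]].
have xe : x.1 != e by rewrite eq_sym.
have ye : y.1 != e by rewrite eq_sym.
have p1 : x.2 != p x.1 e.
  apply: contra_neq eLx => h; rewrite [x in L x]surjective_pairing h Lp //.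
have p3 : y.2 != p y.1 e.
  apply: contra_neq eLy => h; rewrite [y in L y]surjective_pairing h Lp //.
have p2 : p e y.1 != p e x.1.
  apply: contra_neq xy1 => h; have := Lp ex; rewrite -h Lp //.
  by case=> ->.
have pm0 := partial_start (l0 x.1 _ (bicA _ _ p1)); rewrite at_copy2 in pm0.
set z1 := (_, p x.1 e) in pm0.
have Lz1 : L z1 = (e, p e x.1) by rewrite Lp.
have e1 : (L z1).1 \notin [set x.1] by rewrite Lz1 inE.
have q1 : p e y.1 != (L z1).2 by rewrite Lz1.
have pm1 := partial_extend pm0 (set22 _ _) e1 (ok _) q1 (l0 _ _ (bicA _ _ _)).
rewrite eq_sym q1 in pm1; have {}pm1 := pm1 isT.
set z2 := (_, p e y.1) in pm1; have z2E : z2 = (e, p e y.1) by rewrite /z2 Lz1.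
have Lz2 : L z2 = (y.1, p y.1 e) by rewrite z2E Lp.
have e2 : (L z2).1 \notin (L z1).1 |: [set x.1].
  by rewrite Lz2 Lz1 !inE negb_or /= ye eq_sym.
have q2 : y.2 != (L z2).2 by rewrite Lz2.
have pm2 := partial_extend pm1 (setU11 _ _) e2 (ok _) q2 (l0 _ _ (bicA _ _ _)).
rewrite eq_sym q2 in pm2; have {}pm2 := pm2 isT.
have := fill _ _ pm2; rewrite Lz2 -!surjective_pairing.
congr (matchable _ (~: _)); apply/setP=> w; rewrite !inE orbC; congr (_ || _).
have xz1 : x != z1 by rewrite [x]surjective_pairing xpair_eqE negb_and p1 orbT.
have xz2 : x != z2 by rewrite [x]surjective_pairing z2E xpair_eqE (negPf xe).
have [->|_] := eqVneq w x; first by rewrite xz1 xz2 orbT.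
by rewrite /= andbC; case: (w == z1); case: (w == z2).
Qed.

End Copies.

(** * The DCell as linked copies *)

Lemma dcell_orderS k n : dcell_order k.+1 n = (dcell_order k n).+1 * dcell_order k n.
Proof. by rewrite /dcell_order /= card_prod card_ord. Qed.

Lemma dcell_uid_lt k n (x : dcell_vertex k n) : dcell_uid x < dcell_order k n.
Proof.
elim: k x => [|k IHk] x; first by rewrite /dcell_order /= card_ord.
rewrite dcell_orderS mulSnr /=; have := ltn_ord x.1; rewrite ltnS => xk.
by rewrite -addnS leq_add ?IHk // leq_mul2r xk orbT.
Qed.

Fixpoint dcell_of_uid k : nat -> dcell_vertex k 2 :=
  match k return nat -> dcell_vertex k 2 with
  | 0 => fun u => inord u
  | k'.+1 => fun u =>
      (inord (u %/ dcell_order k' 2), dcell_of_uid k' (u %% dcell_order k' 2))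
  end.

Lemma dcell_uidK k : cancel (@dcell_uid k 2) (@dcell_of_uid k).
Proof.
elim: k => [|k IHk] x /=; first by rewrite inord_val.
have lt := dcell_uid_lt x.2; have gt0 := leq_ltn_trans (leq0n _) lt.
rewrite divnMDl // divn_small // addn0 modnMDl modn_small // IHk.
by rewrite inord_val -surjective_pairing.
Qed.

Lemma dcell_of_uidK k u : u < dcell_order k 2 -> dcell_uid (dcell_of_uid k u) = u.
Proof.
elim: k u => [|k IHk] u; first by rewrite /dcell_order /= card_ord => /inordK.
rewrite dcell_orderS /= => lt.
have gt0 : 0 < dcell_order k 2 by case: (dcell_order k 2) lt; rewrite ?muln0.
rewrite IHk ?ltn_mod // inordK; first by rewrite -divn_eq.
by rewrite ltn_divLR.
Qed.

Section Link.

Variable k : nat.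
Notation V := (dcell_vertex k 2).
Notation N := (dcell_order k 2).
Notation I := 'I_(#|V|.+1).

(* The vertex of copy [a] that is linked to copy [b]. *)
Definition port (a b : I) : V := dcell_of_uid k (if b < a then b : nat else b.-1).

(** [dcell_link] solved for its other end: in copy [a], a uid [u < a] leads down to copy [u], and
    any other uid leads up to copy [u.+1]. *)
Definition link (w : I * V) : I * V :=
  let u := dcell_uid w.2 in
  if u < w.1 then (inord u, dcell_of_uid k w.1.-1)
  else (inord u.+1, dcell_of_uid k w.1).

Lemma uid_port a b : a != b -> dcell_uid (port a b) = if b < a then b : nat else b.-1.
Proof.
move=> ab; apply: dcell_of_uidK; rewrite /dcell_order.
have := ltn_ord b; rewrite ltnS; case: (ltngtP b a) ab => [ba _ _|ab _|/ord_inj->].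
- by apply: leq_trans ba _; rewrite -ltnS.
- by rewrite (ltn_predK ab).
- by rewrite eqxx.
Qed.

Lemma link_port a b : a != b -> link (a, port a b) = (b, port b a).
Proof.
move=> ab; rewrite /link uid_port //= /port.
case: (ltngtP b a) ab => [ba _|ab _|/ord_inj->]; last by rewrite eqxx.
  by rewrite ba inord_val.
have -> : (b.-1 < a) = false by apply/negbTE; rewrite -leqNgt -ltnS (ltn_predK ab).
by rewrite (ltn_predK ab) inord_val.
Qed.

Lemma link_portE w : w.1 != (link w).1 /\ w.2 = port w.1 (link w).1.
Proof.
have lt : (dcell_uid w.2).+1 < #|V|.+1 by rewrite ltnS; apply: dcell_uid_lt.
rewrite /link /port -val_eqE; case: ltnP => uw /=.
  rewrite inordK; last by apply: ltnW.
  by rewrite uw dcell_uidK neq_ltn uw orbT.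
rewrite inordK // ltnNge (leq_trans uw) //= dcell_uidK.
by rewrite neq_ltn ltnS uw.
Qed.

Lemma link_neq w : (link w).1 != w.1.
Proof. by rewrite eq_sym; case: (link_portE w). Qed.

Lemma linkE w : link w = ((link w).1, port (link w).1 w.1).
Proof.
have [n e] := link_portE w.
have wE : w = (w.1, port w.1 (link w).1) by rewrite -e -surjective_pairing.
by rewrite {1}wE link_port.
Qed.

Lemma linkK : involutive link.
Proof.
move=> w; have [n e] := link_portE w; rewrite (linkE w) link_port 1?eq_sym //.
by rewrite -e -surjective_pairing.
Qed.

Lemma dcell_adjSE (w z : dcell_vertex k.+1 2) :
  dcell_adj w z = ((w.1 == z.1) && dcell_adj w.2 z.2) || (link w == z).
Proof.
rewrite /=; congr (_ || _).
have fwd (x y : dcell_vertex k.+1 2) : dcell_link x y ->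
    x.1 != y.1 /\ x.2 = port x.1 y.1 /\ y.2 = port y.1 x.1.
  case/and3P=> xy /eqP ux /eqP uy; split; first by rewrite -val_eqE neq_ltn xy.
  rewrite /port xy ltnNge (ltnW xy) /=.
  by rewrite -uy dcell_uidK -subn1 -ux dcell_uidK.
have bwd (a b : I) : a < b -> dcell_link ((a, port a b) : dcell_vertex k.+1 2) (b, port b a).
  move=> ab; have nab : a != b by rewrite -val_eqE neq_ltn ab.
  have nba : b != a by rewrite eq_sym.
  rewrite /dcell_link /= (uid_port nab) (uid_port nba) ab ltnNge (ltnW ab) /=.
  by rewrite subn1 !eqxx.
apply/orP/eqP=> [[/fwd|/fwd]|<-].
- move=> [n [e1 e2]]; rewrite [w]surjective_pairing e1 link_port //.
  by rewrite -e2 -surjective_pairing.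
- move=> [n [e1 e2]]; rewrite [w]surjective_pairing e2 link_port 1?eq_sym //.
  by rewrite -e1 -surjective_pairing.
have [n e] := link_portE w; rewrite linkE [w in dcell_link w]surjective_pairing.
rewrite [w in X in _ \/ X]surjective_pairing.
move: e n; move: (link w).1 => b -> n.
case: (ltngtP w.1 b) => [/bwd|/bwd|/ord_inj h]; [by left|by right|].
by rewrite h eqxx in n.
Qed.

End Link.

(** Colour [l] consists of the links created at level [l], and colour 0 of the initial edges. *)
Fixpoint dcell_colour k : nat -> dcell_vertex k 2 -> dcell_vertex k 2 :=
  match k return nat -> dcell_vertex k 2 -> dcell_vertex k 2 with
  | 0 => fun _ x => rev_ord x
  | k'.+1 => copies_colour k'.+1 (@dcell_colour k') (@link k')
  end.

Lemma dcell_colouring k : colouring (@dcell_adj k 2) k.+1 (@dcell_colour k).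
Proof.
elim: k => [|k IHk].
  split=> [j x _|j l x|x y] /=; first exact: rev_ordK.
    by case: j l => [|//] [].
  split=> [xy|[_ _ <-]]; last by case: x => -[|[|]].
  exists 0 => //; apply/val_inj; move: xy.
  by case: x y => -[|[|//]] ? [[|[|//]] ?].
exact: (copies_colouring IHk (@linkK k) (@link_neq k) (@dcell_adjSE k)).
Qed.

Lemma dcell_triangle_free k : triangle_free (@dcell_adj k 2).
Proof.
elim: k => [|k IHk].
  by case=> [[|[|//]] ?] [[|[|//]] ?] [[|[|//]] ?].
exact: (copies_triangle_free (@dcell_adj_irrefl k 2) (@linkK k) (@link_neq k)
  (@dcell_adjSE k)).
Qed.

Lemma dcell_square_free k : square_free (@dcell_adj k 2).
Proof.
elim: k => [|k IHk].
  by case=> [[|[|//]] ?] [[|[|//]] ?] [[|[|//]] ?] [[|[|//]] ?].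
exact: (copies_square_free (@dcell_adj_sym k 2) (@dcell_adj_irrefl k 2) (@linkK k)
  (@link_neq k) (fun w => proj2 (link_portE w)) (@dcell_adjSE k)).
Qed.

(** * The 42 vertices of the second level *)

(** [dcell_order] is a cardinal and does not compute well; this recursion does. *)
Fixpoint cell_order k : nat := if k is k'.+1 then (cell_order k').+1 * cell_order k' else 2.

Lemma dcell_orderE k : dcell_order k 2 = cell_order k.
Proof.
elim: k => [|k IHk]; first by rewrite /dcell_order card_ord.
by rewrite dcell_orderS IHk.
Qed.

Lemma cell_order_ge k : 1 < k -> 4 * k.+1 + 6 < cell_order k.
Proof.
elim: k => [|[|[|k]] IHk] // _.
have {IHk} := IHk isT; have -> : cell_order k.+3 = (cell_order k.+2).+1 * cell_order k.+2 by [].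
by move: (cell_order k.+2) => t; nia.
Qed.

(** [dcell_colour] carried over to uids, so that it can be evaluated on plain numbers. *)
Fixpoint colour_uid k (j u : nat) : nat :=
  if k is k'.+1 then
    let a := u %/ cell_order k' in
    let r := u %% cell_order k' in
    if j < k then a * cell_order k' + colour_uid k' j r
    else if r < a then r * cell_order k' + a.-1 else r.+1 * cell_order k' + a
  else 1 - u.

Lemma dcell_colour_uid k j (x : dcell_vertex k 2) :
  dcell_uid (dcell_colour j x) = colour_uid k j (dcell_uid x).
Proof.
elim: k x => [|k IHk] x; first by rewrite /= subSS.
have lt := dcell_uid_lt x.2; have gt0 := leq_ltn_trans (leq0n _) lt.
have lt' : (dcell_uid x.2).+1 < #|dcell_vertex k 2|.+1 by rewrite ltnS.
rewrite [colour_uid _ _ _]/= [in RHS]/= -dcell_orderE.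
rewrite divnMDl // divn_small // addn0 modnMDl modn_small //.
rewrite [dcell_colour _ _]/= /copies_colour; case: ifP => _ /=; first by rewrite IHk.
rewrite /link; case: ltnP => ux /=.
  rewrite inordK ?dcell_of_uidK //; last exact: ltnW.
  rewrite (ltn_predK ux) -ltnS; exact: ltn_ord.
by rewrite inordK // dcell_of_uidK // (leq_ltn_trans ux).
Qed.

Local Arguments dcell_uid : simpl never.
Local Arguments dcell_colour : simpl never.

Lemma dcell2_uid (x : dcell_vertex 2 2) : dcell_uid x \in iota 0 42.
Proof. by have := dcell_uid_lt x; rewrite dcell_orderE mem_iota. Qed.

Definition partners : seq (seq nat) :=
  Eval vm_compute in [seq [seq colour_uid 2 j u | u <- iota 0 42] | j <- iota 0 3].

Definition partner j u := nth 0 (nth [::] partners j) u.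

Lemma partnerE j (x : dcell_vertex 2 2) :
  j < 3 -> dcell_uid (dcell_colour j x) = partner j (dcell_uid x).
Proof.
move=> j3; rewrite dcell_colour_uid.
have check : all (fun j => all (fun u => colour_uid 2 j u == partner j u) (iota 0 42)) (iota 0 3).
  by vm_compute.
have jP : j \in iota 0 3 by rewrite mem_iota.
exact: eqP (allP (allP check j jP) _ (dcell2_uid x)).
Qed.

(* [t] lists the colours of the edges that match the vertices of [D_{2,2}],
   given by their uid, other than those of [R]. *)
Definition certifies (t R : seq nat) : bool :=
  all (fun u => (u \in R) ||
    let j := nth 0 t u in
    [&& j < 3, partner j u \notin R & nth 0 t (partner j u) == j]) (iota 0 42).

Lemma certified_matching (t R : seq nat) (H : {set {set dcell_vertex 2 2}}) :
    certifies t R ->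
    (forall x, [set x; dcell_colour (nth 0 t (dcell_uid x)) x] \notin H) ->
  matchable (live (@dcell_adj 2 2) H) [set x | dcell_uid x \notin R].
Proof.
move=> tR nH; have [cK _ _] := dcell_colouring 2.
apply/matchableP; exists (fun x => dcell_colour (nth 0 t (dcell_uid x)) x) => x.
rewrite in_set => xR; set u := dcell_uid x; set j := nth 0 t u.
have := allP tR _ (dcell2_uid x); rewrite (negPf xR) orFb -/u -/j.
case/and3P=> j3 pR /eqP pj; have mu : dcell_uid (dcell_colour j x) = partner j u.
  exact: partnerE.
rewrite in_set mu pj; split=> //; first exact: cK.
by rewrite /live nH andbT; apply: (colour_edge (dcell_colouring 2)).
Qed.

(* Depth-first search, from the three colour classes, of matchings missing only
   [x] and another vertex [y]: the vertex matched to a neighbour [z] of [y]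
   becomes the second unmatched vertex once [z] is matched to [y]. *)
Fixpoint search (fuel x : nat) (stack : seq (nat * seq nat)) (seen : seq (nat * seq nat)) :=
  if (fuel, stack) is (fuel'.+1, (y, t) :: stack') then
    if y \in [seq s.1 | s <- seen] then search fuel' x stack' seen
    else
      let next := [seq (let z := partner l y in (partner (nth 0 t z) z,
                    set_nth 0 (set_nth 0 t z l) y l))
                  | l <- [seq l <- [:: 2; 1; 0] | partner l y != x]] in
      search fuel' x (next ++ stack') ((y, t) :: seen)
  else seen.

Definition near_matchings x : seq (nat * seq nat) :=
  search 200 x [seq (partner j x, nseq 42 j) | j <- [:: 2; 1; 0]] [::].

(** The search itself is not trusted: [certifies] checks its outputs, which also shows that the fuel
    is enough. A pair may be found from either of its vertices. *)
Lemma near_matchings_check :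
  let near := [seq near_matchings x | x <- iota 0 42] in
  let covers x y := has (fun s => certifies s.2 [:: x; y])
                        [seq s <- nth [::] near x | s.1 == y] in
  all (fun x => all (fun y => covers x y || covers y x) (iota 0 x)) (iota 0 42).
Proof. by vm_compute. Qed.

Lemma dcell2_bicritical : bicritical (@dcell_adj 2 2).
Proof.
have cov (t : seq (nat * seq nat)) x y :
    has (fun s => certifies s.2 [:: dcell_uid x; dcell_uid y]) t ->
    matchable (@dcell_adj 2 2) (~: [set x; y]).
  case/hasP=> s _ cs.
  have := certified_matching (H := set0) cs (fun z => negbT (in_set0 _)).
  have -> : [set z | dcell_uid z \notin [:: dcell_uid x; dcell_uid y]] = ~: [set x; y].
    by apply/setP=> z; rewrite !inE !(can_eq (@dcell_uidK 2)).
  by apply: matchable_sub => u v _ _ /andP[].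
move=> x y; wlog yx : x y / dcell_uid y < dcell_uid x => [main xy|_].
  case: (ltngtP (dcell_uid y) (dcell_uid x)) => [|lt|/(can_inj (@dcell_uidK 2)) h].
  - by move/main; apply.
  - by rewrite setUC; apply: main => //; rewrite eq_sym.
  - by rewrite h eqxx in xy.
have yP : dcell_uid y \in iota 0 (dcell_uid x) by rewrite mem_iota.
have /orP[] := allP (allP near_matchings_check _ (dcell2_uid x)) _ yP.
  exact: cov.
by rewrite setUC; apply: cov.
Qed.

(* Perfect matchings of [D_{2,2}], as colours, such that any three edges of
   different colours that do not isolate a vertex are avoided by one of them. *)
Definition matching_family : seq (seq nat) := [::
  [:: 1; 2; 1; 2; 0; 0; 1; 2; 1; 1; 2; 1; 2; 2; 2; 2; 0; 0; 0; 0; 2;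
      1; 2; 1; 2; 1; 2; 1; 1; 1; 1; 2; 1; 2; 0; 0; 0; 0; 0; 0; 0; 0];
  [:: 2; 1; 2; 1; 1; 1; 2; 1; 0; 0; 1; 2; 1; 1; 1; 1; 1; 1; 2; 1; 0;
      0; 1; 2; 0; 0; 0; 0; 2; 2; 0; 0; 0; 0; 2; 2; 1; 2; 1; 2; 2; 2];
  [:: 0; 0; 0; 0; 2; 2; 0; 0; 0; 0; 0; 0; 0; 0; 0; 0; 2; 2; 1; 1; 1;
      1; 1; 1; 1; 1; 1; 1; 1; 1; 2; 1; 2; 1; 1; 1; 2; 1; 2; 1; 1; 1];
  [:: 1; 1; 1; 2; 1; 2; 0; 0; 2; 2; 0; 0; 1; 1; 1; 2; 1; 2; 1; 2; 1;
      2; 0; 0; 2; 2; 2; 2; 0; 0; 1; 1; 1; 1; 1; 1; 2; 1; 2; 1; 1; 1];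
  [:: 0; 0; 2; 1; 2; 1; 0; 0; 2; 2; 2; 2; 0; 0; 2; 1; 2; 1; 2; 2; 2;
      2; 2; 2; 1; 2; 1; 2; 0; 0; 2; 2; 2; 2; 0; 0; 1; 2; 1; 2; 0; 0];
  [:: 1; 2; 1; 1; 2; 1; 1; 2; 1; 1; 2; 1; 2; 2; 0; 0; 0; 0; 1; 1; 1;
      1; 1; 1; 0; 0; 0; 0; 2; 2; 2; 2; 0; 0; 2; 2; 0; 0; 0; 0; 2; 2];
  [:: 0; 0; 0; 0; 0; 0; 1; 2; 1; 2; 0; 0; 1; 2; 1; 1; 2; 1; 0; 0; 0;
      0; 2; 2; 1; 2; 1; 1; 2; 1; 0; 0; 2; 2; 2; 2; 1; 1; 1; 2; 1; 2];
  [:: 2; 2; 0; 0; 2; 2; 2; 1; 0; 0; 1; 2; 2; 1; 2; 1; 1; 1; 0; 0; 2;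
      2; 0; 0; 1; 1; 1; 2; 1; 2; 2; 1; 0; 0; 1; 2; 2; 2; 0; 0; 2; 2];
  [:: 2; 1; 2; 1; 1; 1; 2; 1; 2; 1; 1; 1; 0; 0; 0; 0; 0; 0; 2; 2; 0;
      0; 0; 0; 0; 0; 0; 0; 0; 0; 1; 1; 1; 1; 1; 1; 1; 1; 1; 1; 1; 1];
  [:: 1; 2; 1; 2; 0; 0; 1; 2; 1; 2; 0; 0; 2; 2; 0; 0; 2; 2; 1; 1; 1;
      1; 1; 1; 2; 2; 0; 0; 2; 2; 0; 0; 2; 1; 2; 1; 0; 0; 2; 1; 2; 1];
  [:: 2; 1; 0; 0; 1; 2; 2; 2; 0; 0; 2; 2; 1; 2; 1; 2; 0; 0; 1; 1; 1;
      1; 1; 1; 0; 0; 2; 1; 2; 1; 1; 2; 1; 1; 2; 1; 2; 2; 0; 0; 0; 0];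
  [:: 2; 2; 0; 0; 0; 0; 2; 2; 0; 0; 0; 0; 2; 2; 0; 0; 0; 0; 0; 0; 0;
      0; 0; 0; 1; 1; 1; 1; 1; 1; 0; 0; 0; 0; 0; 0; 1; 1; 1; 1; 1; 1]].

(** In a 3-regular graph, three faults of different colours isolate a vertex exactly when they share
    it; it is then an end of the edge of colour 0. *)
Definition isolating u0 u1 u2 : bool :=
  has (fun v => [&& (v == u0) || (v == partner 0 u0), (v == u1) || (v == partner 1 u1)
                  & (v == u2) || (v == partner 2 u2)]) [:: u0; partner 0 u0].

Definition avoiding (j u : nat) (ts : seq (seq nat)) := [seq t <- ts | nth 0 t u != j].

Definition ends (j : nat) : seq nat := [seq u <- iota 0 42 | u < partner j u].

Lemma matching_family_certified : all (fun t => certifies t [::]) matching_family.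
Proof. by vm_compute. Qed.

Lemma matching_family_check :
  all (fun u0 => let ts0 := avoiding 0 u0 matching_family in
    all (fun u1 => let ts1 := avoiding 1 u1 ts0 in
      all (fun u2 => isolating u0 u1 u2 || (avoiding 2 u2 ts1 != [::])) (ends 2))
    (ends 1))
  (ends 0).
Proof. by vm_compute. Qed.

(** Unless some colour class has no fault, [H] consists of one edge of each colour, and these
    triples are finitely many to check. *)
Lemma dcell2_resilient (H : {set {set dcell_vertex 2 2}}) :
    #|H| <= 3 -> (forall x, exists y, live (@dcell_adj 2 2) H x y) ->
  matchable (live (@dcell_adj 2 2) H) setT.
Proof.
move=> cH noiso; have col := dcell_colouring 2; have [cK c_inj eP] := col.
have [j jH|hit] := pickP [pred j : 'I_3 |
    [forall x, [set x; dcell_colour j x] \notin H]].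
  by apply: (matchable_colour col (ltn_ord j)) => x _; rewrite inE (forallP jH).
have {}hit j : j < 3 -> exists x, [set x; dcell_colour j x] \in H /\
    dcell_uid x \in ends j.
  move=> j3; have /forallPn[x] := negbT (hit (Ordinal j3)); rewrite negbK /= => xH.
  have := colour_neq (@dcell_adj_irrefl 2 2) col x j3.
  rewrite -(can_eq (@dcell_uidK 2)) neq_ltn => /orP[] lt; last first.
    by exists x; rewrite mem_filter -partnerE // lt dcell2_uid.
  exists (dcell_colour j x); rewrite cK // setUC; split=> //.
  by rewrite mem_filter -partnerE // cK // lt dcell2_uid.
have [x0 [x0H e0]] := hit 0 isT; have [x1 [x1H e1]] := hit 1 isT.
have [x2 [x2H e2]] := hit 2 isT.
have nE j l (x y : dcell_vertex 2 2) : j < 3 -> l < 3 ->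
    [set x; dcell_colour j x] = [set y; dcell_colour l y] -> j = l.
  move=> j3 l3 /set2_eq[][xy h]; apply: (c_inj j l x j3 l3); rewrite h ?xy //.
  by rewrite cK.
have HE : H = [set x0; dcell_colour 0 x0] |:
    [set [set x1; dcell_colour 1 x1]; [set x2; dcell_colour 2 x2]].
  apply/esym/eqP; rewrite eqEcard !subUset !sub1set x0H x1H x2H /=.
  apply: leq_trans cH _; rewrite cardsU1 cards2 !inE negb_or.
  have -> : [set x1; dcell_colour 1 x1] != [set x2; dcell_colour 2 x2].
    by apply/eqP=> /nE-/(_ isT isT).
  have -> : [set x0; dcell_colour 0 x0] != [set x1; dcell_colour 1 x1].
    by apply/eqP=> /nE-/(_ isT isT).
  have -> // : [set x0; dcell_colour 0 x0] != [set x2; dcell_colour 2 x2].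
  by apply/eqP=> /nE-/(_ isT isT).
have /orP[/hasP[v _]|] := allP (allP (allP matching_family_check _ e0) _ e1) _ e2.
  have vE j (x : dcell_vertex 2 2) : j < 3 -> [set x; dcell_colour j x] \in H ->
      (v == dcell_uid x) || (v == partner j (dcell_uid x)) ->
      [set dcell_of_uid 2 v; dcell_colour j (dcell_of_uid 2 v)] \in H.
    move=> j3 xH; rewrite -partnerE // => /orP[]/eqP->; rewrite dcell_uidK //.
    by rewrite cK // setUC.
  case/and3P=> /(vE 0 x0 isT x0H) v0 /(vE 1 x1 isT x1H) v1 /(vE 2 x2 isT x2H) v2.
  have [y /andP[/eP[j j3 <-]]] := noiso (dcell_of_uid 2 v).
  by case: j j3 => [|[|[|//]]] _; rewrite ?v0 ?v1 ?v2.
case E: (avoiding _ _ _) => [//|t ts] _.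
have : t \in avoiding 2 (dcell_uid x2)
    (avoiding 1 (dcell_uid x1) (avoiding 0 (dcell_uid x0) matching_family)).
  by rewrite E mem_head.
rewrite !mem_filter => /and4P[t2 t1 t0 tF].
have ct := allP matching_family_certified _ tF.
have -> : [set: dcell_vertex 2 2] = [set x | dcell_uid x \notin [::]].
  by apply/setP=> x; rewrite !inE.
apply: certified_matching (ct) _ => x; apply/negP=> xH.
have /and3P[j3 _ /eqP tj] := allP ct _ (dcell2_uid x).
set j := nth 0 t (dcell_uid x) in xH j3 tj.
rewrite -partnerE // in tj.
(* [t] gives both ends of a matched edge the same colour, so testing one end of a fault suffices. *)
have tne l (y : dcell_vertex 2 2) : l < 3 -> nth 0 t (dcell_uid y) != l ->
    [set x; dcell_colour j x] != [set y; dcell_colour l y].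
  move=> l3 ty; apply/eqP=> /[dup]/nE-/(_ j3 l3) jl /set2_eq[][xy _].
    by rewrite -xy -jl eqxx in ty.
  have yx : y = dcell_colour j x by rewrite xy jl cK.
  by rewrite yx tj jl eqxx in ty.
by move: xH; rewrite HE !inE (negPf (tne 0 _ _ t0)) // (negPf (tne 1 _ _ t1)) //
  (negPf (tne 2 _ _ t2)).
Qed.

(** * Trivial solutions *)

Section Twin.

Variables (T : finType) (e : rel T) (d : nat) (c : nat -> T -> T).
Hypotheses (se : symmetric e) (ie : irreflexive e) (col : colouring e d c).
Hypothesis tf : triangle_free e.

Definition twin u v w : {set {set T}} :=
  (star e u :\ [set u; v]) :|: (star e w :\ [set w; v]).

Variables (u v w : T).
Hypotheses (uw : u != w) (uv : e u v) (vw : e v w).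

Lemma star_edge x y : e x y -> [set x; y] \in star e x.
Proof. by move=> xy; apply/imsetP; exists y; rewrite ?inE. Qed.

(** An edge in both stars would be [u w], which closes a triangle with [v]. *)
Lemma card_twin : #|twin u v w| = 2 * d.-1.
Proof.
have cS x y : e x y -> #|star e x :\ [set x; y]| = d.-1.
  move=> xy; have := cardsD1 [set x; y] (star e x).
  by rewrite (card_star col) star_edge // => ->.
rewrite cardsU !cS ?mul2n -?addnn //; last by rewrite se.
rewrite (_ : _ :&: _ = set0) ?cards0 ?subn0 //; apply/setP=> f; rewrite !inE.
apply/negP=> /andP[/andP[_ /starP[y uy ->]] /andP[_ /starP[z wz]]].
move/set2_eq=> [[h _]|[h1 h2]]; first by have := uw; rewrite h eqxx.
by have := tf uv vw; rewrite -h2 uy.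
Qed.

Lemma twin_ends f : f \in twin u v w -> (u \in f) || (w \in f).
Proof. by rewrite !inE => /orP[]/andP[_ /starP[y _ ->]]; rewrite !inE eqxx ?orbT. Qed.

Lemma twin_sub (F : {set {set T}}) :
    (forall z, e u z -> z != v -> [set u; z] \in F) ->
    (forall z, e w z -> z != v -> [set w; z] \in F) ->
  twin u v w \subset F.
Proof.
move=> uF wF; apply/subsetP=> f; rewrite !inE => /orP[]/andP[+ /starP[y xy fE]].
  by rewrite fE (inj_eq (@set2_inj _ u)); apply: uF.
by rewrite fE (inj_eq (@set2_inj _ w)); apply: wF.
Qed.

Lemma live_twin x : live e (twin u v w) u x -> x = v.
Proof.
move=> /andP[ux]; rewrite !inE negb_or star_edge // andbT negbK.
by case/andP=> /eqP/set2_inj.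
Qed.

Lemma live_twin_middle : live e (twin u v w) u v.
Proof.
rewrite /live uv !inE eqxx /=; apply/negP=> /andP[_ /starP[y _ /set2_eq[][h1 h2]]].
  by have := uw; rewrite h1 eqxx.
by have := vw; rewrite h2 ie.
Qed.

End Twin.

(** * Perfect matchings as edge sets *)

Section PerfectMatching.

Variable G : sgraph.
Implicit Types (F : {set {set G}}).
Notation e := (@adj G).

Lemma edges_edge_set F : F \subset edges G -> edge_set e F.
Proof. by move=> /subsetP FE f /FE/imsetP[[x y]]; rewrite inE => xy ->; exists x, y. Qed.

Lemma matchable_perfect : matchable e setT -> has_perfect_matching G.
Proof.
case/matchableP=> m mP.
have mm x : m (m x) = x by have [] := mP x (in_setT x).
apply/existsP; exists [set [set x; m x] | x in setT]; apply/andP; split.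
  apply/subsetP=> f /imsetP[x xT ->]; apply/imsetP; exists (x, m x) => //.
  by rewrite inE; have [] := mP x xT.
apply/forallP=> x; apply/cards1P; exists [set x; m x]; apply/setP=> f.
rewrite !inE; apply/andP/eqP=> [[/imsetP[y _ ->]]|->].
  by rewrite !inE => /orP[]/eqP->; rewrite ?mm // setUC.
by rewrite !inE eqxx; split=> //; apply/imsetP; exists x.
Qed.

Lemma perfect_partner (M : {set {set G}}) x : perfect_matching M ->
  exists2 y, e x y & [set x; y] \in M.
Proof.
case/andP=> /subsetP ME /forallP/(_ x)/cards1P[f fE].
have : f \in [set f in M | x \in f] by rewrite fE set11.
rewrite inE => /andP[fM]; have /imsetP[[a b]] := ME _ fM; rewrite inE /= => ab fab.
move: fM; rewrite fab => abM; rewrite !inE => /orP[]/eqP->; first by exists b.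
by exists a; rewrite 1?adj_sym // setUC.
Qed.

Lemma perfect_unique (M : {set {set G}}) x y z : perfect_matching M ->
  [set x; y] \in M -> [set x; z] \in M -> y = z.
Proof.
case/andP=> _ /forallP/(_ x)/cards1P[f fE] xy xz.
apply: (@set2_inj _ x); transitivity f.
  by apply/set1P; rewrite -fE inE xy set21.
by apply/esym/set1P; rewrite -fE inE xz set21.
Qed.

Lemma isolated_free : ~~ has_isolated_vertex G -> forall x, exists y, e x y.
Proof.
move=> /existsPn noiso x; have := noiso x; rewrite -lt0n => /card_gt0P[y].
by rewrite inE; exists y.
Qed.

End PerfectMatching.

(** * Trivial solutions preclude perfect matchings *)

Section TwinDeletion.

Variables (G : sgraph) (d : nat) (c : nat -> G -> G).
Hypotheses (col : colouring (@adj G) d c) (tf : triangle_free (@adj G)) (d3 : 2 < d).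
Implicit Types (u v w : G).
Notation e := (@adj G).

Lemma twin_edges u v w : path2 u v w ->
  [set f in edges G | (u \in f) || (w \in f)] :\: [set [set u; v]; [set v; w]]
  = twin e u v w.
Proof.
case/and3P=> uw uv vw; apply/setP=> f.
have edgeP x : (f \in edges G) && (x \in f) = (f \in star e x).
  apply/andP/idP=> [[/imsetP[[a b]]]|/starP[y xy ->]].
    rewrite inE /= => ab ->; rewrite !inE => /orP[]/eqP->; first exact: star_edge.
    by rewrite setUC star_edge // adj_sym.
  split; last by rewrite set21.
  by apply/imsetP; exists (x, y); rewrite ?inE.
rewrite !in_setD in_set andb_orr !edgeP !inE [[set v; w]]setUC negb_or.
have [fu|nfu] := boolP (f \in star e u); have [fw|nfw] := boolP (f \in star e w);
  rewrite ?andbT ?andbF ?orbF //=.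
- have [y uy fE] := starP fu; have [z wz fE'] := starP fw.
  move: (fE'); rewrite fE => /set2_eq[[h _]|[h1 h2]]; first by rewrite h eqxx in uw.
  by have := tf uv vw; rewrite -h2 uy.
- rewrite andb_idr // => _; apply: contraNneq nfw => ->.
  by apply: star_edge; rewrite adj_sym.
- rewrite andb_idl // => _; apply: contraNneq nfu => ->; exact: star_edge.
Qed.

(** After the deletion [u] and [w] compete for [v]. Any other vertex has degree at least 3, so it
    keeps an edge to a vertex other than [u] and [w]. *)
Lemma twin_preclusion u v w : path2 u v w -> cond_preclusion (twin e u v w).
Proof.
move=> p2; have /and3P[uw uv vw] := p2.
have se := @adj_sym G; have ie := @adj_irrefl G.
have wu : w != u by rewrite eq_sym.
have vu : e v u by rewrite se.
have wv : e w v by rewrite se.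
have twC : twin e u v w = twin e w v u by rewrite /twin setUC.
have leaf x : live e (twin e u v w) w x -> x = v.
  by rewrite twC; apply: live_twin.
apply/and3P; split.
- by rewrite -twin_edges //; apply/subsetP=> f; rewrite !inE => /andP[_ /andP[]].
- apply/existsPn=> M; apply/negP=> pM.
  have [y /live_twin ->] := @perfect_partner (del_edges (twin e u v w)) M u pM.
  have [z /leaf ->] := @perfect_partner (del_edges (twin e u v w)) M w pM.
  rewrite setUC [[set u; v]]setUC => vwM vuM.
  by move: uw; rewrite (@perfect_unique (del_edges (twin e u v w)) M v u w pM vuM vwM) eqxx.
apply/existsPn=> x; rewrite -lt0n; apply/card_gt0P.
suff [y xy] : exists y, live e (twin e u v w) x y by exists y; rewrite inE.
have lu : live e (twin e u v w) u v by apply: live_twin_middle.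
have lw : live e (twin e u v w) w v by rewrite twC; apply: live_twin_middle.
have [->|xu] := eqVneq x u; first by exists v.
have [->|xw] := eqVneq x w; first by exists v.
have /set0Pn[y] : [set y | e x y] :\: [set u; w] != set0.
  rewrite -card_gt0 cardsD (card_neighbours col) subn_gt0.
  apply: leq_ltn_trans d3; apply: leq_trans (subset_leq_card (subsetIr _ _)) _.
  by rewrite cards2 uw.
rewrite !inE negb_or => /andP[/andP[yu yw] xy]; exists y; apply/andP; split=> //.
apply/negP=> /twin_ends; rewrite !inE [u == x]eq_sym [u == y]eq_sym.
by rewrite [w == x]eq_sym [w == y]eq_sym (negPf xu) (negPf xw) (negPf yu) (negPf yw).
Qed.

Lemma ve_path u v w : path2 u v w -> ve_val u w = 2 * d.-1.
Proof.
case/and3P=> _ uv vw; rewrite /ve_val /degree !(card_neighbours col).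
by rewrite (negPf (tf uv vw)); clear -d3; lia.
Qed.

Lemma is_ve_twin : inhabited G -> is_ve G (2 * d.-1).
Proof.
case=> v; have d0 : 0 < d by clear -d3; lia.
have d1 : 1 < d by clear -d3; lia.
have [_ c_inj _] := col.
have p2 : path2 (c 0 v) v (c 1 v).
  rewrite /path2 adj_sym !(colour_edge col) // !andbT.
  by apply/eqP=> /c_inj-/(_ d0 d1).
split; first by exists (c 0 v), v, (c 1 v); rewrite (ve_path p2).
by move=> u' v' w' /ve_path ->.
Qed.

End TwinDeletion.

(** * Induction on the level *)

Lemma dcell_bicritical k : 1 < k -> bicritical (@dcell_adj k 2).
Proof.
elim: k => [|[|[|k]] IHk] // _; first exact: dcell2_bicritical.
apply: (copies_bicritical (@dcell_adj_sym _ 2) (dcell_colouring _) (@linkK _)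
  (@link_neq _) (@link_port _) (@dcell_adjSE _)) (IHk isT) => //.
rewrite card_ord -/(dcell_order k.+2 2) dcell_orderE; have := @cell_order_ge k.+2 isT.
by clear; lia.
Qed.

(** The bound is [2 * k - 1], one less than the claimed preclusion number; it is written in terms of
    the degree [k.+1]. *)
Definition resilient k : Prop := forall F : {set {set dcell_vertex k 2}},
  edge_set (@dcell_adj k 2) F -> #|F| <= 2 * k.+1 - 3 ->
  (forall x, exists y, live (@dcell_adj k 2) F x y) ->
  matchable (live (@dcell_adj k 2) F) setT.

(** The budget [2 * k.+1] is the preclusion number of level [k.+1] itself, so this yields both the
    lower bound and the shape of the optimal solutions. *)
Lemma dcell_twin_stars k (F : {set {set dcell_vertex k.+1 2}}) :
    1 < k -> resilient k -> edge_set (@dcell_adj k.+1 2) F -> #|F| <= 2 * k.+1 ->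
    (forall x, exists y, live (@dcell_adj k.+1 2) F x y) ->
    ~~ matchable (live (@dcell_adj k.+1 2) F) setT ->
  twin_stars (@dcell_adj k.+1 2) F.
Proof.
move=> k1 res eF cF noiso nopm; have := cell_order_ge k1; rewrite -dcell_orderE => ok.
apply: (preclusion_twin_stars (@dcell_adj_sym k 2) (@dcell_adj_irrefl k 2)
  (dcell_colouring k) (@linkK k) (@link_neq k) (@link_port k)
  (fun w => proj2 (link_portE w)) (@dcell_adjSE k) eF (dcell_bicritical k1)) => //.
- by apply: leq_ltn_trans ok; clear; lia.
- by rewrite card_ord ltnS ltnW.
- exact: dcell_square_free.
Qed.

Lemma resilientS k : 1 < k -> resilient k -> resilient k.+1.
Proof.
move=> k1 res F eF cF noiso; apply: contraLR cF => nopm; rewrite -ltnNge.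
have [|cF] := ltnP (2 * k.+1) #|F|; first by apply: leq_trans; clear; lia.
have [u [v [w [uw uv vw uF wF]]]] := dcell_twin_stars k1 res eF cF noiso nopm.
have cT := card_twin (@dcell_adj_sym k.+1 2) (dcell_colouring k.+1)
  (@dcell_triangle_free k.+1) uw uv vw.
apply: (@leq_trans (2 * k.+1.+1.-1)); first by clear; lia.
by rewrite -cT; apply: subset_leq_card (twin_sub uF wF).
Qed.

Lemma dcell_resilient k : 1 < k -> resilient k.
Proof.
elim: k => [|[|[|k]] IHk] // _; last exact: resilientS (IHk isT).
by move=> F eF cF noiso; apply: dcell2_resilient.
Qed.

Theorem theorem27 (k n : nat) (hk : 2 <= k) (hn : n = 2) :
  [/\ is_mp1 (dcell k n) (2 * n + 2 * k - 4),
      2 * n + 2 * k - 4 = 2 * k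
    & 3 <= k -> cond_super_matched (dcell k n)].
Proof.
subst n; have -> : 2 * 2 + 2 * k - 4 = 2 * k by rewrite addKn.
have col : colouring (@adj (dcell k 2)) k.+1 (@dcell_colour k) := dcell_colouring k.
have tf : triangle_free (@adj (dcell k 2)) := @dcell_triangle_free k.
have isve : is_ve (dcell k 2) (2 * k).
  exact: (is_ve_twin col tf hk (inhabits (dcell_of_uid k 0))).
have nopm (F : {set {set dcell k 2}}) : cond_preclusion F -> [/\ edge_set (@dcell_adj k 2) F,
    ~~ matchable (live (@dcell_adj k 2) F) setT
  & forall x, exists y, live (@dcell_adj k 2) F x y].
  case/and3P=> /edges_edge_set eF npm niso; split=> //.
    by apply: contra npm; apply: (@matchable_perfect (del_edges F)).
  exact: (@isolated_free (del_edges F)).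
have mp1 : is_mp1 (dcell k 2) (2 * k).
  split; last first.
    move=> F /nopm[eF npm niso]; rewrite leqNgt; apply: contra npm => cF.
    by apply: dcell_resilient => //; move: cF; move: #|F|; clear; lia.
  have [[u [v [w [p2 _]]]] _] := isve; have /and3P[uw uv vw] := p2.
  exists (twin (@adj (dcell k 2)) u v w); first exact: (twin_preclusion col tf hk p2).
  exact: (card_twin (@dcell_adj_sym k 2) col tf uw uv vw).
split=> //; case: k hk col tf isve nopm mp1 => // k hk col tf isve nopm mp1 hk3.
exists (2 * k.+1); split=> // F /nopm[eF npm niso] cF.
have [u [v [w [uw uv vw uF wF]]]] :=
  dcell_twin_stars hk3 (dcell_resilient hk3) eF (eq_leq cF) niso npm.
have p2 : @path2 (dcell k.+1 2) u v w by apply/and3P.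
have vE := ve_path col tf hk p2.
have fE := twin_edges tf p2.
exists u, v, w; split; [exact: p2 | by rewrite vE | rewrite fE].
(* [F] contains the trivial solution and has the same size, so they are equal. *)
apply/esym/eqP; rewrite eqEcard; apply/andP; split; first exact: twin_sub uF wF.
by rewrite cF -(card_twin (@dcell_adj_sym k.+1 2) col tf uw uv vw).
Qed.
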